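(* (Classical monodromy matrices.) Let $p\ge2$, $q\ge1$ be coprime integers, $\omega=e^{2\pi i/p}$. For $n=0,1,\dots,2p-1$ let $\gamma_n^*$ denote analytic continuation in $\lambda$ once counter-clockwise around the branch point $\lambda_n=\frac12(2\sqrt\mu)^{1/p}\omega^{n/2}$, along the small loop $t\mapsto\lambda_n+e^{2\pi it}(\lambda-\lambda_n)$, $t\in[0,1]$. Then the Chebyshev solution $\varphi(\lambda)$ and the classical $Z$ function $Z_{\rm cl}(\lambda)$ satisfy $$\gamma_n^*\varphi(\lambda)=C_n^{-1}\varphi(\lambda)C_n,\qquad \gamma_n^*Z_{\rm cl}(\lambda)=Z_{\rm cl}(\lambda)C_n,$$ where $$C_n=\prod_{\substack{1\le j<l\le p\\ j+l\equiv n+2\ (\mathrm{mod}\ p)}}\mathbf C_{l,j}\big(\omega^{-\frac{l-j}{2}}\big),\qquad \mathbf C_{l,j}(\alpha)=I_p+\alpha E_{l,j}-\tfrac1\alpha E_{j,l}-E_{l,l}-E_{j,j},$$ and $\omega^{s}=e^{2\pi is/p}$, $E_{a,b}$ being matrix units.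
   Context: $\mu>0$, $\beta$ is a nonzero real constant, $r=p+q$. Variables: $(2\lambda)^p=2\sqrt\mu\cosh(p\tau)$. For $|\lambda|>\frac12(2\sqrt\mu)^{1/p}$ take $\mathrm{Re}\,\tau>0$ and $e^\tau\sim2\lambda\mu^{-1/(2p)}$ as $\lambda\to\infty$. Put $\tau_j=\tau-2\pi i\frac{j-1}{p}$. The Chebyshev solution is $\varphi=\mathrm{diag}(\varphi^{(1)},\dots,\varphi^{(p)})$ with $$\varphi^{(j)}=\frac{p\beta\mu^{r/(2p)}}{2}\Big[\frac{\cosh((p+q)\tau_j)}{p+q}-\frac{\cosh((q-p)\tau_j)}{q-p}\Big].$$ The classical $Z$ function is the $p\times p$ matrix $$Z_{\rm cl}(\lambda)_{ij}=\frac1p\,\frac{1}{\sqrt{\Delta^{(j)}(\lambda)}}\sum_{n=1}^p\big(\omega^{i-1}\gamma^{(j)}(\lambda)\big)^{n-1},\qquad \gamma^{(j)}(\lambda)=\frac{\mu^{1/(2p)}\cosh\tau_j}{\lambda},$$ $$\sqrt{\Delta^{(j)}(\lambda)}=\prod_{1\le a\le p,\ a\ne j}\sqrt{\frac{\gamma^{(j)}(\lambda)-\gamma^{(a)}(\lambda)}{\omega^{-(j-1)}-\omega^{-(a-1)}}},$$ with $\gamma^{(j)}(\lambda)=\omega^{-(j-1)}+O(\lambda^{-1})$ and each square-root factor $=1+O(\lambda^{-1})$ as $\lambda\to\infty$. All these functions are holomorphic in $|\lambda|>\frac12(2\sqrt\mu)^{1/p}$; the values at the base point $\lambda$ (near $\lambda_n$,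 with $|\lambda|>|\lambda_n|$, e.g. $(\lambda-\lambda_n)/\lambda_n>0$ small) are those determined by the normalization at infinity. The factors in the product defining $C_n$ commute. *)

(* Defs.v *)
From HB Require Import structures.
From mathcomp Require Import all_boot all_order all_algebra.
From mathcomp Require Import all_classical all_reals all_analysis.
From mathcomp Require Import complex.
Import Order.TTheory GRing.Theory Num.Theory.
Import numFieldNormedType.Exports.
Set Implicit Arguments.
Unset Strict Implicit.
Unset Printing Implicit Defensive.
Local Open Scope classical_set_scope.
Local Open Scope complex_scope.
Local Open Scope ring_scope.

(* The topology and the normed module structure of the complex plane are
   attached to R[i]^o; derivability in the direction 1 over R[i] is complex
   differentiability. *)

Section ComplexAnalysis.
Variable R : realType.
Implicit Types (A : set R[i]) (f g : R[i] -> R[i]) (path : R -> R[i]).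

Definition cexp (z : R[i]) : R[i] :=
  (expR (complex.Re z))%:C * (cos (complex.Im z) +i* sin (complex.Im z)).

Definition ccosh (z : R[i]) : R[i] := (cexp z + cexp (- z)) / 2.

(* A is meant to be open. *)
Definition holomorphic_on A f : Prop :=
  forall z, A z -> derivable (f : R[i]^o -> R[i]^o) z 1.

Definition disc (c : R[i]) (r : R) : set R[i] := [set z | `|z - c| < r%:C].

(* Neighbourhoods of infinity in the Riemann sphere. *)
Definition cinfty : set_system R[i] :=
  [set P | exists M : R, forall z : R[i], M%:C < `|z| -> P z].

(* The germ of f at path 0 continues analytically along path, t in [0, 1], to
   the germ of g at path 1: there is a family of function elements
   (F t, disc (path t) (r t)) whose germs along the path are locally
   compatible.  By the identity theorem the germ of g is determined by path
   and the germ of f. *)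
Definition analytic_continuation path f g : Prop :=
  exists (r : R -> R) (F : R -> R[i] -> R[i]),
    [/\ forall t, 0 <= t <= 1 ->
          0 < r t /\ holomorphic_on (disc (path t) (r t)) (F t),
        \forall z \near (path 0 : R[i]^o), F 0 z = f z,
        \forall z \near (path 1 : R[i]^o), F 1 z = g z
      & forall t, 0 <= t <= 1 ->
          exists2 e : R, 0 < e &
            forall u, 0 <= u <= 1 -> `|u - t| < e ->
              disc (path t) (r t) (path u) /\
              \forall z \near (path u : R[i]^o), F u z = F t z].

Definition mx_analytic_continuation m n path (A B : R[i] -> 'M[R[i]]_(m, n)) :
    Prop :=
  forall i j, analytic_continuation path (fun z => A z i j) (fun z => B z i j).

Definition small_loop (c z : R[i]) (t : R) : R[i] :=
  c + cexp (0 +i* (2 * pi * t)) * (z - c).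

End ComplexAnalysis.

(* Indices j, l, a, i range over 'I_p, i.e. over 0, ..., p - 1, and stand for
   the mathematical indices j + 1, l + 1, a + 1, i + 1. *)

Section Chebyshev.
Variables (R : realType) (mu beta : R) (p q : nat).
Implicit Types (tau : R[i] -> R[i]) (sf : 'I_p -> 'I_p -> R[i] -> R[i]).

(* omega ^ x, with omega = exp (2 pi i / p) *)
Definition omega_pow (x : R) : R[i] := cexp (0 +i* (2 * pi * x / p%:R)).

Definition branch_radius : R := 2^-1 * (2 * Num.sqrt mu) `^ (p%:R^-1).

Definition branch_point (n : nat) : R[i] :=
  (branch_radius)%:C * omega_pow (n%:R / 2).

Definition exterior : set R[i] := [set z | (branch_radius)%:C < `|z|].

(* Only exp tau is single-valued on the exterior domain, so tau is an arbitrary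
   pointwise choice of logarithm of a holomorphic function. *)
Definition is_uniformizer tau : Prop :=
  [/\ forall z, exterior z ->
        (2 * z) ^+ p = (2 * Num.sqrt mu)%:C * ccosh (p%:R * tau z),
      forall z, exterior z -> 0 < complex.Re (tau z),
      holomorphic_on exterior (fun z => cexp (tau z))
    & (fun z => cexp (tau z) / (2 * z * (mu `^ (- (2 * p%:R)^-1))%:C))
        @ @cinfty R --> (1 : R[i]^o)].

Definition tau_sheet tau (j : 'I_p) (z : R[i]) : R[i] :=
  tau z - (0 +i* (2 * pi * j%:R / p%:R)).

Definition chebyshev_entry tau (j : 'I_p) (z : R[i]) : R[i] :=
  (p%:R * beta * mu `^ ((p + q)%:R / (2 * p%:R)) / 2)%:C *
  (ccosh ((p%:R + q%:R) * tau_sheet tau j z) / (p%:R + q%:R)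
   - ccosh ((q%:R - p%:R) * tau_sheet tau j z) / (q%:R - p%:R)).

Definition chebyshev_solution tau (z : R[i]) : 'M[R[i]]_p :=
  diag_mx (\row_(j < p) chebyshev_entry tau j z).

Definition gamma_fun tau (j : 'I_p) (z : R[i]) : R[i] :=
  (mu `^ ((2 * p%:R)^-1))%:C * ccosh (tau_sheet tau j z) / z.

(* sf j a is the branch, equal to 1 + O(1/z) at infinity, of the square root
   of (gamma_j - gamma_a) / (omega ^ (- j) - omega ^ (- a)). *)
Definition is_sqrt_factors tau sf : Prop :=
  forall j a : 'I_p, a != j ->
    [/\ forall z, exterior z ->
          sf j a z ^+ 2 = (gamma_fun tau j z - gamma_fun tau a z)
                          / (omega_pow (- j%:R) - omega_pow (- a%:R)),
        holomorphic_on exterior (sf j a)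
      & exists K : R, \forall z \near @cinfty R,
          `|sf j a z - 1| <= K%:C / `|z|].

Definition sqrt_Delta sf (j : 'I_p) (z : R[i]) : R[i] :=
  \prod_(a < p | a != j) sf j a z.

Definition Z_cl tau sf (z : R[i]) : 'M[R[i]]_p :=
  \matrix_(i < p, j < p)
    (p%:R^-1 * (sqrt_Delta sf j z)^-1 *
     \sum_(k < p) (omega_pow i%:R * gamma_fun tau j z) ^+ k).

Definition exchange_mx (l j : 'I_p) (alpha : R[i]) : 'M[R[i]]_p :=
  1%:M + alpha *: delta_mx l j - alpha^-1 *: delta_mx j l
  - delta_mx l l - delta_mx j j.

(* With indices starting at 0, the condition j + l = n + 2 mod p becomes
   j + l = n mod p.  The factors have disjoint supports, hence commute. *)
Definition monodromy_mx (n : nat) : 'M[R[i]]_p :=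
  \big[mulmx/1%:M]_(jl : 'I_p * 'I_p |
      (jl.1 < jl.2)%N && (jl.1 + jl.2 == n %[mod p])%N)
    exchange_mx jl.2 jl.1 (omega_pow (- ((jl.2)%:R - (jl.1)%:R) / 2)).

End Chebyshev.

(* Main.v *)
(* Put x = z / b with b the branch radius and s = sqrt (1 - x ^ -2p), which has
   positive real part on the exterior domain.  Comparing p-th powers, and values
   at infinity along rays, gives the closed forms
     exp tau = x (1 + s) ^ (1/p),
     sf j a = sqrt (const (1 + s) ^ (1/p)) sqrt (1 - omega ^ (j + a) exp (-2 tau)),
   with principal roots.  Near a branch point c = lambda_n all functions at hand
   are therefore holomorphic in r = s ^ (1/2), and one turn of z around c
   multiplies r by i, i.e. changes the sign of s.  This sends exp tau to
   omega ^ n / exp tau, hence the sheet j to the sheet n - j, and the branch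
   constants acquired by the square roots multiply up to the entries of the
   monodromy matrix: those attached to the p-th roots of unity zeta and zeta ^ -1
   cancel, except for zeta = 1, where a fourth root contributes i. *)
Require Import Defs.
From HB Require Import structures.
From mathcomp Require Import all_boot all_order all_algebra.
From mathcomp Require Import all_classical all_reals all_analysis.
From mathcomp Require Import complex ring lra.
Import Order.TTheory GRing.Theory Num.Theory.
Import numFieldNormedType.Exports.
Local Open Scope classical_set_scope.
Local Open Scope complex_scope.
Local Open Scope ring_scope.
Set Implicit Arguments.
Unset Strict Implicit.
Unset Printing Implicit Defensive.

(** The base point lies in the exterior domain, but the loop leaves it, and nothing is assumed about
    tau or the square-root factors outside. The function elements along the loop are therefore
    composites of a function Phi, holomorphic on a punctured disc around 0, with local fourth roots
    of sigma; the given functions enter only through their identification with such a composite near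
    the base point. As tau is merely a pointwise logarithm, every argument goes through exp tau.

    Branches are compared by algebra and continuity alone. Two functions with equal k-th powers have
    a k-th root of unity as ratio; these roots are isolated, so one common value or limit forces
    equality nearby. The same principle identifies the closed forms at infinity, the germs along the
    loop and the branch point near which z lies. *)

Local Notation hol f z := (derivable (f : _^o -> _^o) z 1).
Local Notation Re := complex.Re.
Local Notation Im := complex.Im.

(** * Complex differentiability *)

Section Holomorphy.
Variable R : realType.
Local Notation C := (R[i]^o).
Implicit Types (f g : C -> C) (z : C).

Lemma normCE (x : R[i]) : `|x| = (Num.sqrt (complex.Re x ^+ 2 + complex.Im x ^+ 2))%:C.
Proof. exact: normc_def. Qed.

(** Balls over [R[i]] have radii in [R[i]]; positivity forces them to be real. *)
Lemma nearC (z : C) (P : C -> Prop) :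
  (\forall x \near z, P x) <-> exists2 e : R, 0 < e & forall x : R[i], `|x - z| < e%:C -> P x.
Proof.
split.
  move=> /nbhs_ballP[e /= e0 eP].
  have er : e = (complex.Re e)%:C by rewrite RRe_real ?gtr0_real.
  exists (complex.Re e); first by move: e0; rewrite er -ltcR.
  move=> x xz; apply: eP; rewrite -ball_normE /= distrC er //.
move=> [e e0 eP]; apply/nbhs_ballP; exists e%:C => /=; first by rewrite ltcR.
by move=> x; rewrite -ball_normE /= distrC => /eP.
Qed.

Lemma hol_comp f g z : hol g z -> hol f (g z) -> hol (f \o g) z.
Proof.
move=> /derivable1_diffP dg /derivable1_diffP df.
apply/derivable1_diffP; exact: (@differentiable_comp _ C C C g f z dg df).
Qed.

Lemma hol_cts f z : hol f z -> {for z, continuous f}.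
Proof. by move=> /derivable1_diffP; exact: differentiable_continuous. Qed.

Lemma hol_cst (c : C) z : hol (fun=> c) z.
Proof. exact: derivable_cst. Qed.

Lemma hol_id z : hol (fun x => x) z.
Proof. exact: derivable_id. Qed.

Lemma holD f g z : hol f z -> hol g z -> hol (fun x => f x + g x) z.
Proof. exact: derivableD. Qed.

Lemma holB f g z : hol f z -> hol g z -> hol (fun x => f x - g x) z.
Proof. exact: derivableB. Qed.

Lemma holN f z : hol f z -> hol (fun x => - f x) z.
Proof. exact: derivableN. Qed.

Lemma holM f g z : hol f z -> hol g z -> hol (fun x => f x * g x : C) z.
Proof. exact: derivableM. Qed.

Lemma holV f z : hol f z -> f z != 0 -> hol (fun x => (f x)^-1 : C) z.
Proof. by move=> hf f0; exact: derivableV. Qed.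

Lemma holX f z n : hol f z -> hol (fun x => f x ^+ n : C) z.
Proof.
move=> hf; elim: n => [|n IH]; first exact: hol_cst.
by under eq_fun do rewrite exprS; exact: holM.
Qed.

Lemma hol_sum (I : Type) (s : seq I) (P : pred I) (F : I -> C -> C) z :
  (forall i, P i -> hol (F i) z) -> hol (fun x => \sum_(i <- s | P i) F i x) z.
Proof.
move=> h; elim: s => [|i s IH]; first by under eq_fun do rewrite big_nil; exact: hol_cst.
under eq_fun do rewrite big_cons.
case Pi : (P i); [exact: (holD (h i Pi) IH)|exact: IH].
Qed.

Lemma hol_prod (I : Type) (s : seq I) (P : pred I) (F : I -> C -> C) z :
  (forall i, P i -> hol (F i) z) -> hol (fun x => \prod_(i <- s | P i) F i x : C) z.
Proof.
move=> h; elim: s => [|i s IH]; first by under eq_fun do rewrite big_nil; exact: hol_cst.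
under eq_fun do rewrite big_cons.
case Pi : (P i); [exact: (holM (h i Pi) IH)|exact: IH].
Qed.

Lemma cvg_real_complex (T : Type) (F : set_system T) {FF : Filter F} (u : T -> R) (l : R) :
  u @ F --> l -> (fun t => (u t)%:C : C) @ F --> (l%:C : C).
Proof.
move=> ul; apply/cvgrPdist_lt => e e0.
have er : e = (complex.Re e)%:C by rewrite RRe_real ?gtr0_real.
have e0' : 0 < complex.Re e by move: e0; rewrite er -ltcR.
move/cvgrPdist_lt : ul => /(_ _ e0'); apply: filterS => t.
by rewrite -rmorphB normCE /= expr0n addr0 sqrtr_sqr [in X in _ -> X]er ltcR.
Qed.

Lemma cvgC (T : Type) (F : set_system T) {FF : Filter F} (u : T -> R[i]) (l : R[i]) :
  (fun t => complex.Re (u t)) @ F --> complex.Re l ->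
  (fun t => complex.Im (u t)) @ F --> complex.Im l ->
  (u : T -> C) @ F --> (l : C).
Proof.
move=> h1 h2.
have -> : (u : T -> C) = (fun t => (complex.Re (u t))%:C + 'i%C * (complex.Im (u t))%:C : C).
  by apply/funext => t; rewrite [LHS]complexE.
rewrite (complexE l).
apply: (@cvgD _ C); first exact: cvg_real_complex.
apply: cvgM; [exact: cvg_cst|exact: cvg_real_complex].
Qed.

Lemma Re_cts z : {for z, continuous (@complex.Re R : C -> R)}.
Proof.
 apply: (iffRL (@cvgrPdist_lt _ R^o _ (nbhs z) (nbhs_filter z) _ _)) => e e0.
apply/nearC; exists e => // x xz; rewrite -raddfB.
by rewrite -ltcR; apply: le_lt_trans (normc_ge_Re _) _; rewrite distrC.
Qed.

Lemma Im_cts z : {for z, continuous (@complex.Im R : C -> R)}.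
Proof.
 apply: (iffRL (@cvgrPdist_lt _ R^o _ (nbhs z) (nbhs_filter z) _ _)) => e e0.
apply/nearC; exists e => // x xz; rewrite -raddfB.
rewrite -ltcR -normrN -ReiNIm; apply: le_lt_trans (normc_ge_Re _) _.
have -> : `|(z - x) * 'i%C| = `|z - x|; last by rewrite distrC.
by rewrite normrM [X in _ * X]normCE /= expr0n add0r expr1n sqrtr1 mulr1.
Qed.

(** Factoring g(z + h)^k - g(z)^k = h shows that the difference quotient of g is 1 / Q(z + h), and
    by continuity Q tends to k g(z)^(k - 1), which is nonzero. *)
Lemma hol_inverse_pow (k : nat) (g : C -> C) (z : C) : (0 < k)%N ->
  {for z, continuous g} -> g z != 0 -> (\forall x \near z, g x ^+ k = x) -> hol g z.
Proof.
move=> k0 gc gz gk.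
pose Q (x : C) : C := \sum_(i < k) g x ^+ (k.-1 - i) * g z ^+ i.
have Qz : Q z != 0.
  rewrite /Q (eq_bigr (fun=> g z ^+ k.-1)).
    by rewrite sumr_const card_ord -mulr_natr mulf_neq0 ?expf_neq0 // pnatr_eq0 -lt0n.
  move=> i _; rewrite -exprD subnK // -ltnS prednK //.
pose P (y : C) : C := \sum_(i < k) y ^+ (k.-1 - i) * g z ^+ i.
have Pc : {for g z, continuous P}.
  apply: hol_cts; apply: hol_sum => i _; apply: holM; last exact: hol_cst.
  by apply: holX; exact: hol_id.
have Qc : {for z, continuous Q} by exact: (@continuous_comp C C C g P z gc Pc).
have gkz := nbhs_singleton gk.
have hz : (fun h : C => h + z) @ 0^' --> z.
  have hz0 : (fun h : C => h + z) @ nbhs (0 : C) --> (0 + z : C).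
    by apply: cvgD; [exact: cvg_id|exact: cvg_cst].
  rewrite add0r in hz0.
  exact: (@cvg_within_filter C C _ _ _ (nbhs z) _ hz0).
have lim : (fun h : C => (Q (h + z))^-1 : C) @ 0^' --> ((Q z)^-1 : C).
  apply: (@cvgV C _ _ _ (fun h : C => Q (h + z)) (Q z) Qz).
  exact: (cvg_comp (fun h : C => h + z) Q hz Qc).
apply/cvg_ex; exists ((Q z)^-1); apply: cvg_trans lim; apply: near_eq_cvg.
near=> h.
have h0 : h != 0 by near: h; exact: nbhs_dnbhs_neq.
have gk' : g (h + z) ^+ k = h + z by near: h; exact: (hz _ gk).
have E : (g (h + z) - g z) * Q (h + z) = h by rewrite /Q -subrXX gkz gk' addrK.
have Q0 : Q (h + z) != 0 by apply: contra_neq h0 => Q0; rewrite -E Q0 mulr0.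
rewrite /= /shift /= [h *: 1]mulr1; apply: (mulfI h0).
by rewrite [h * (_ *: _)]mulrA divff // mul1r -{1}E mulfK.
Unshelve. all: by end_near.
Qed.

End Holomorphy.

(** * Exponential and principal roots *)

Section Roots.
Variable R : realType.
Local Notation C := (R[i]^o).
Implicit Types (x y z : R[i]) (k : nat).

Lemma cexpD x y : cexp (x + y) = cexp x * cexp y.
Proof.
case: x y => [a b] [c d]; rewrite /cexp /= expRD cosD sinD.
by apply/eqP; rewrite eq_complex /=; apply/andP; split; apply/eqP; ring.
Qed.

Lemma cexp0 : cexp 0 = 1 :> R[i].
Proof. by rewrite /cexp /= expR0 cos0 sin0 mul1r. Qed.

Lemma cexpNK x : cexp (- x) * cexp x = 1.
Proof. by rewrite -cexpD addNr cexp0. Qed.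

Lemma cexp_neq0 x : cexp x != 0.
Proof.
apply/eqP => e; have := cexpNK x.
by rewrite e mulr0 => /esym/eqP; rewrite oner_eq0.
Qed.

Lemma cexpN x : cexp (- x) = (cexp x)^-1.
Proof. by apply: (mulIf (cexp_neq0 x)); rewrite cexpNK mulVf ?cexp_neq0. Qed.

Lemma cexpMn k x : cexp (k%:R * x) = cexp x ^+ k.
Proof.
elim: k => [|k IH]; first by rewrite mul0r cexp0.
by rewrite exprS -IH -cexpD mulrS mulrDl mul1r.
Qed.

Lemma normc_cexp x : `|cexp x| = (expR (Re x))%:C.
Proof.
rewrite /cexp normrM !normCE /= expr0n /= addr0 sqrtr_sqr cos2Dsin2 sqrtr1 mulr1.
by rewrite ger0_norm ?expR_ge0.
Qed.

Lemma Re_cexp_gt0 x : `|Im x| < pi / 2 -> 0 < Re (cexp x).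
Proof.
rewrite ltr_norml => xp; rewrite /cexp /= mul0r subr0 mulr_gt0 ?expR_gt0 //.
exact: cos_gt0_pihalf.
Qed.

(** Principal logarithm of the right half-plane: this arctangent is the argument only when the real
    part is positive. *)
Definition clog z : R[i] := ln (Re `|z|) +i* atan (Im z / Re z).

Lemma Re_norm z : (Re `|z|)%:C = `|z|.
Proof. by rewrite RRe_real ?normr_real. Qed.

Lemma cexp_clog z : 0 < Re z -> cexp (clog z) = z.
Proof.
move=> z0.
have nz : z != 0 by apply: contraTneq z0 => ->; rewrite /= ltxx.
have n_gt0 : 0 < Re `|z| by rewrite -ltcR Re_norm normr_gt0.
rewrite /clog.
have n2 : Re `|z| ^+ 2 = Re z ^+ 2 + Im z ^+ 2.
  by rewrite normCE /= sqr_sqrtr // addr_ge0 ?sqr_ge0.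
move: n_gt0 n2; set n := Re `|z| => n_gt0 n2.
rewrite /cexp /= lnK //.
have sin_atan (t : R) : sin (atan t) = t * cos (atan t).
  by rewrite -{2}[t]atanK /tan divfK // cos_atan invr_eq0 gt_eqF // sqrtr_gt0 ltr_pwDl ?sqr_ge0.
rewrite sin_atan cos_atan.
have -> : Num.sqrt (1 + (Im z / Re z) ^+ 2) = n / Re z.
  have -> : 1 + (Im z / Re z) ^+ 2 = (n / Re z) ^+ 2.
    by rewrite !expr_div_n n2; field; rewrite gt_eqF.
  by rewrite sqrtr_sqr ger0_norm // divr_ge0 // ltW.
apply/eqP; rewrite eq_complex /=; apply/andP; split; apply/eqP; field;
  rewrite ?gt_eqF ?mulr_gt0 ?invr_gt0 ?andbT //.
Qed.

Definition proot k z : R[i] := cexp (clog z / k%:R).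

Lemma proot_pow k z : (0 < k)%N -> 0 < Re z -> proot k z ^+ k = z.
Proof.
move=> k0 z0; rewrite -cexpMn mulrC divfK ?cexp_clog //.
by rewrite pnatr_eq0 -lt0n.
Qed.

Lemma proot_neq0 k z : proot k z != 0.
Proof. exact: cexp_neq0. Qed.

Lemma divr_natC x k : x / k%:R = (Re x / k%:R) +i* (Im x / k%:R).
Proof.
have -> : (k%:R : R[i])^-1 = (k%:R^-1)%:C by rewrite fmorphV rmorph_nat.
by case: x => a b; apply/eqP; rewrite eq_complex /=; apply/andP; split; apply/eqP; ring.
Qed.

(** The arctangent bounds the imaginary part of [clog z] by pi / 2, and division by k preserves the
    bound. *)
Lemma Re_proot k z : (0 < k)%N -> 0 < Re (proot k z).
Proof.
move=> k0; apply: Re_cexp_gt0; rewrite divr_natC /=.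
have [h1 h2] := (atan_gtNpi2 (Im z / Re z), atan_ltpi2 (Im z / Re z)).
rewrite normrM (@ger0_norm _ (_^-1)) ?invr_ge0 ?ler0n //.
apply: (@le_lt_trans _ _ `|atan (Im z / Re z)|).
  rewrite ler_piMr // invf_le1 ?ltr0n // ler1n //.
by rewrite ltr_norml -mulNr mulNr h1 h2.
Qed.

Lemma proot_real k (x : R) : 0 < x -> proot k x%:C = (x `^ (k%:R^-1))%:C.
Proof.
move=> x0; rewrite /proot divr_natC /clog /= mul0r atan0 mul0r /cexp /= cos0 sin0.
have -> : (1 +i* 0 : R[i]) = 1 by [].
rewrite mulr1 expr0n /= addr0 sqrtr_sqr gtr0_norm // /powR gt_eqF //.
by rewrite mulrC.
Qed.

Lemma proot1 k : proot k 1 = 1.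
Proof. by rewrite (@proot_real k 1) // powR1. Qed.

Lemma cexp_cts (z : C) : {for z, continuous (@cexp R : C -> C)}.
Proof.
have h1 : (fun x : C => expR (Re x)) @ z --> expR (Re z).
  exact: (@continuous_comp C R R (@complex.Re R) expR z (@Re_cts R z) (@continuous_expR R (Re z))).
have h2 : (fun x : C => cos (Im x)) @ z --> cos (Im z).
  exact: (@continuous_comp C R R (@complex.Im R) cos z (@Im_cts R z) (@continuous_cos R (Im z))).
have h3 : (fun x : C => sin (Im x)) @ z --> sin (Im z).
  exact: (@continuous_comp C R R (@complex.Im R) sin z (@Im_cts R z) (@continuous_sin R (Im z))).
have c1 := @cvg_real_complex R C (nbhs z) (nbhs_filter z) _ _ h1.
have c2 := @cvgC R C (nbhs z) (nbhs_filter z)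
  (fun x : C => cos (Im x) +i* sin (Im x)) (cos (Im z) +i* sin (Im z)) h2 h3.
exact: (@cvgM C _ _ (nbhs_filter z) _ _ _ _ c1 c2).
Qed.

Lemma norm_cts (z : C) : {for z, continuous (fun z : C => Re `|z|)}.
Proof.
apply: (iffRL (@cvgrPdist_lt _ R^o _ (nbhs z) (nbhs_filter z) _ _)) => e e0.
apply/nearC; exists e => // x xz; rewrite -raddfB.
rewrite -ltcR; apply: le_lt_trans (normc_ge_Re _) _.
by apply: le_lt_trans (ler_dist_dist _ _) _; rewrite distrC.
Qed.

Lemma Re_gt0_neq0 z : 0 < Re z -> z != 0.
Proof. by move=> z0; apply: contraTneq z0 => ->; rewrite /= ltxx. Qed.

Lemma proot_cts k (z : C) : 0 < Re z -> {for z, continuous (proot k : C -> C)}.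
Proof.
move=> z0.
have z0' := Re_gt0_neq0 z0.
have lnc : {for Re `|z|, continuous (@ln R)}.
  by apply: continuous_ln; rewrite -ltcR Re_norm normr_gt0.
have h1 : (fun x : C => ln (Re `|x|)) @ z --> ln (Re `|z|).
  exact: (@continuous_comp C R R (fun z => Re `|z|) (@ln R) z (@norm_cts z) lnc).
have hd : (fun x : C => Im x / Re x) @ z --> Im z / Re z.
  have nz : Re z != 0 by rewrite gt_eqF.
  exact: (@cvgM R _ _ (nbhs_filter z) _ _ _ _ (@Im_cts R z)
            (@cvgV R _ _ (nbhs_filter z) _ _ nz (@Re_cts R z))).
have h2 : (fun x : C => atan (Im x / Re x)) @ z --> atan (Im z / Re z).
  exact: (@continuous_comp C R R (fun x => Im x / Re x) (@atan R) z hd (@continuous_atan R _)).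
have h3 := @cvgC R C (nbhs z) (nbhs_filter z) (@clog : C -> R[i]) (clog z) h1 h2.
have h4 : (fun x : C => clog x / k%:R : C) @ z --> (clog z / k%:R : C).
  exact: (@cvgM C _ _ (nbhs_filter z) _ _ _ _ h3 (cvg_cst _)).
exact: (@continuous_comp C C C (fun z : C => clog z / k%:R) (@cexp R : C -> C) z h4 (@cexp_cts _)).
Qed.

Lemma near_Re_gt0 (z : C) : 0 < Re z -> \forall x \near z, 0 < Re x.
Proof. by move=> z0; exact: (@Re_cts R z _ (lt_nbhsr z0)). Qed.

Lemma hol_proot k (z : C) : (0 < k)%N -> 0 < Re z -> hol (proot k) z.
Proof.
move=> k0 z0; apply: (hol_inverse_pow k0); [exact: proot_cts|exact: proot_neq0|].
apply: filterS (near_Re_gt0 z0) => x; exact: proot_pow.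
Qed.

End Roots.

(** * Identification of branches *)

Section Branches.
Variable R : realType.
Local Notation C := (R[i]^o).
Implicit Types (k : nat).

(** The sector of arguments below pi / 4 in absolute value, where principal square roots of the
    right half-plane lie. A product of two such roots stays in the right half-plane, hence is again
    a principal root. *)
Definition sector (x : R[i]) := `|Im x| < Re x.

Lemma sector_Re (x : R[i]) : sector x -> 0 < Re x.
Proof. exact: le_lt_trans (normr_ge0 _). Qed.

Lemma Re_mul (x y : R[i]) : Re (x * y) = Re x * Re y - Im x * Im y.
Proof. by case: x y => [a b] [c d]. Qed.

Lemma sector_sqr (x : R[i]) : 0 < Re x -> 0 < Re (x ^+ 2) -> sector x.
Proof.
rewrite expr2 Re_mul /sector ltr_norml => x0 h.
by apply/andP; split; nra.
Qed.

Lemma sector_proot2 (z : R[i]) : 0 < Re z -> sector (proot 2 z).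
Proof. by move=> z0; apply: sector_sqr; rewrite ?proot_pow // Re_proot. Qed.

Lemma sectorM (x y : R[i]) : sector x -> sector y -> 0 < Re (x * y).
Proof.
rewrite /sector !ltr_norml Re_mul => /andP[x1 x2] /andP[y1 y2].
(* This sum is twice the real part of x y. *)
have : 0 < (Re x + Im x) * (Re y - Im y) + (Re x - Im x) * (Re y + Im y).
  by rewrite addr_gt0 // mulr_gt0; lra.
nra.
Qed.

Lemma sectorV (x : R[i]) : sector x -> sector x^-1.
Proof.
case: x => a b; rewrite /sector /= => h.
have n0 : 0 < a ^+ 2 + b ^+ 2 by have := le_lt_trans (normr_ge0 _) h; nra.
by rewrite normrN normrM (@gtr0_norm _ (_^-1)) ?invr_gt0 // ltr_pM2r ?invr_gt0.
Qed.

Lemma sqr_inj_Re (x y : R[i]) : 0 < Re x -> 0 < Re y -> x ^+ 2 = y ^+ 2 -> x = y.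
Proof.
move=> x0 y0 /eqP; rewrite eqf_sqr => /orP[/eqP//|/eqP e].
by move: x0; rewrite e raddfN oppr_gt0 => /(lt_trans y0); rewrite ltxx.
Qed.

Lemma proot2_uniq (x z : R[i]) : 0 < Re z -> 0 < Re x -> x ^+ 2 = z -> proot 2 z = x.
Proof. by move=> z0 x0 e; apply: sqr_inj_Re; rewrite ?Re_proot // proot_pow. Qed.

Lemma Re_real_mul (a : R) (x : R[i]) : Re (a%:C * x) = a * Re x.
Proof. by rewrite Re_mul /= mul0r subr0. Qed.

Lemma near_neq0 (c : C) : c != 0 -> \forall x \near c, x != 0.
Proof.
move=> c0; apply/nearC; exists (Re `|c|).
  by rewrite -ltcR Re_norm normr_gt0.
move=> x; rewrite Re_norm; apply: contraTneq => ->.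
by rewrite sub0r normrN ltxx.
Qed.

(** 1 is isolated among the k-th roots of unity: in x^k - 1 = (x - 1) P(x) the cofactor has the
    value k at 1. *)
Lemma unity_near1 k : (0 < k)%N -> \forall x \near (1 : C), x ^+ k = 1 -> x = 1.
Proof.
move=> k0; pose P (x : C) : C := \sum_(i < k) x ^+ i.
have Pc : {for (1 : C), continuous P}.
  by apply: hol_cts; apply: hol_sum => i _; apply: holX; exact: hol_id.
have P1 : P 1 != 0.
  rewrite /P (eq_bigr (fun=> 1)) => [|i _]; last by rewrite expr1n.
  by rewrite sumr_const card_ord pnatr_eq0 -lt0n.
have : \forall x \near (1 : C), P x != 0.
  exact: (Pc _ (near_neq0 P1)).
apply: filterS => x Px xk; apply/eqP; rewrite -subr_eq0.
have /eqP : (x - 1) * P x = 0 by rewrite /P -subrX1 xk subrr.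
by rewrite mulf_eq0 (negPf Px) orbF.
Qed.

(** The ratio is a k-th root of unity tending to 1, so it is eventually equal to 1. This takes the
    place of uniqueness of lifts. *)
Lemma pow_eq_near (T : Type) (F : set_system T) {FF : Filter F} k (f g : T -> R[i]) :
  (0 < k)%N -> (fun t => f t / g t : C) @ F --> (1 : C) ->
  (\forall t \near F, g t != 0) -> (\forall t \near F, f t ^+ k = g t ^+ k) ->
  \forall t \near F, f t = g t.
Proof.
move=> k0 fg g0 e; have u := fg _ (unity_near1 k0).
move: u; apply: filterS2 (filterI g0 e) => t [gt et] /=.
rewrite expr_div_n et divff ?expf_neq0 // => /(_ erefl) /(canRL (divfK gt)).
by rewrite mul1r.
Qed.

Lemma pow_eq_cts k (f g : C -> C) (z : C) : (0 < k)%N ->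
  {for z, continuous f} -> {for z, continuous g} -> f z = g z -> g z != 0 ->
  (\forall x \near z, f x ^+ k = g x ^+ k) -> \forall x \near z, f x = g x.
Proof.
move=> k0 fc gc e g0 fg.
have h := @cvgM C _ _ (nbhs_filter z) _ _ _ _ fc (@cvgV C _ _ (nbhs_filter z) _ _ g0 gc).
rewrite e divff // in h.
exact: (@pow_eq_near C (nbhs z) (nbhs_filter z) k f g k0 h (gc _ (near_neq0 g0)) fg).
Qed.

#[global] Instance cinfty_filter : Filter (@cinfty R).
Proof.
split; first by exists 0.
  move=> P Q [M hM] [N hN]; exists (Num.max M N) => z hz.
  by split; [apply: hM|apply: hN]; apply: le_lt_trans hz; rewrite lecR le_max lexx ?orbT.
by move=> P Q PQ [M hM]; exists M => z /hM /PQ.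
Qed.

(** Along the ray t z with t >= 1, the distance from f to 1 is continuous and vanishes far out. It
    cannot take values strictly between 0 and the isolation radius d of the root 1, so it vanishes
    at z too. *)
Lemma unity_exterior (b : R) k (f : C -> C) : (0 < k)%N -> 0 < b ->
  (forall z : C, b%:C < `|z| -> {for z, continuous f}) ->
  (forall z : C, b%:C < `|z| -> f z ^+ k = 1) ->
  f @ @cinfty R --> (1 : C) -> forall z : C, b%:C < `|z| -> f z = 1.
Proof.
move=> k0 b0 fc fk f1 z bz.
have [d d0 hd] := (nearC _ _).1 (unity_near1 k0).
have [M hM] : @cinfty R (fun x => `|f x - 1| < d%:C).
  have nb : \forall x \near (1 : C), `|x - 1| < d%:C by apply/nearC; exists d.
  exact: (f1 _ nb).
have z0 : 0 < Re `|z| by apply: lt_trans b0 _; rewrite -ltcR Re_norm.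
(* Chosen so that |T z| >= M + 1, past the radius M beyond which f is within d of 1. *)
pose T := Num.max 1 ((M + 1) / Re `|z|).
have T1 : 1 <= T by rewrite le_max lexx.
have ntz t : 1 <= t -> `|t%:C * z| = (t * Re `|z|)%:C.
  move=> t1; have nt : `|t%:C| = t%:C :> R[i] by rewrite ger0_norm // ler0c (le_trans _ t1).
  by rewrite normrM nt -{1}(Re_norm z) -rmorphM.
have ext t : 1 <= t -> b%:C < `|t%:C * z|.
  move=> t1; rewrite ntz // ltcR; apply: (@lt_le_trans _ _ (Re `|z|)).
    by rewrite -ltcR Re_norm.
  by rewrite ler_peMl // ltW.
pose g (t : R) : R := Re `|f (t%:C * z) - 1|.
have gT : g T = 0.
  rewrite /g [f _]hd ?subrr ?normr0 // ?fk ?ext //.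
  apply: hM; rewrite ntz // ltcR.
  apply: (@lt_le_trans _ _ (M + 1)); first by rewrite ltrDl.
  by rewrite -ler_pdivrMr // le_max lexx orbT.
have [|g1] := ltP (g 1) d.
  by rewrite /g mul1r -ltcR Re_norm => /hd; apply; rewrite fk.
have gt (t : R) : 1 <= t -> {for t, continuous g}.
  move=> t1.
  have c1 : (fun t : R => t%:C * z : C) @ t --> (t%:C * z : C).
    have c0 := @cvg_real_complex R R (nbhs t) (nbhs_filter t) _ _ (@cvg_id _ _).
    exact: (@cvgM C _ _ (nbhs_filter t) _ _ _ _ c0 (cvg_cst _)).
  have c2 : (fun t : R => f (t%:C * z) : C) @ t --> (f (t%:C * z) : C).
    exact: (cvg_comp _ _ c1 (fc _ (ext _ t1))).
  have c3 : (fun t : R => f (t%:C * z) - 1 : C) @ t --> (f (t%:C * z) - 1 : C).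
    exact: (@cvgB _ C _ _ (nbhs_filter t) _ _ _ _ c2 (cvg_cst (1 : C))).
  exact: (cvg_comp (fun t : R => f (t%:C * z) - 1 : C) (fun x : C => Re `|x|) c3 (@norm_cts R _)).
have gc : {within `[1, T], continuous g}.
  apply: continuous_in_subspaceT => t; rewrite inE /= in_itv /= => /andP[t1 _].
  exact: gt.
(* If g 1 were at least d, the value d / 2 would be attained, although f equals 1 wherever it is
   within d of 1. *)
have [] := @IVT R g 1 T (d / 2) T1 gc.
  have g0 : 0 <= g 1 by lra.
  by rewrite gT min_r // max_l //; apply/andP; split; lra.
move=> t; rewrite in_itv /= => /andP[t1 _] gtd.
have : f (t%:C * z) = 1.
  apply: hd; last by rewrite fk ?ext.
  by rewrite -Re_norm ltcR -[X in X < _]/(g t) gtd; lra.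
move=> e; move: gtd; rewrite /g e subrr normr0 /= => /esym/eqP.
by rewrite gt_eqF // divr_gt0.
Qed.

End Branches.

(** * Continuation around a branch point of order four *)

Section Continuation.
Variable R : realType.
Local Notation C := (R[i]^o).

(* The monodromy problem has [N = 2 * p] and [b] the radius of the branch circle. *)
Definition sigma (b : R) (N : nat) (z : R[i]) : R[i] := 1 - (b%:C / z) ^+ N.

Definition root4 (z : R[i]) : R[i] := proot 2 (proot 2 z).

Lemma root4_pow (z : R[i]) : 0 < Re z -> root4 z ^+ 4 = z.
Proof.
by move=> z0; rewrite (_ : 4 = 2 * 2)%N // exprM !proot_pow ?Re_proot.
Qed.

Lemma hol_root4 (z : C) : 0 < Re z -> hol root4 z.
Proof.
move=> z0; apply: (@hol_comp R (proot 2) (proot 2)); first exact: hol_proot.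
by apply: hol_proot => //; exact: Re_proot.
Qed.

Lemma Re_sub1_gt0 (x : R[i]) : `|x| < 1 -> 0 < Re (1 - x).
Proof.
move=> x1; have := le_lt_trans (normc_ge_Re x) x1.
by rewrite (_ : 1 = 1%:C) // ltcR ltr_norml => /andP[]; rewrite raddfB /= subr_gt0.
Qed.

Lemma norm_sigma_lt1 (b : R) N (z : R[i]) : 0 < b -> (0 < N)%N -> b%:C < `|z| ->
  `|(b%:C / z) ^+ N| < 1.
Proof.
move=> b0 N0 bz; have z0 : 0 < `|z| by apply: lt_trans bz; rewrite ltcR.
rewrite normrX expr_lt1 // normrM normfV ltr_pdivrMr // mul1r.
by rewrite ger0_norm // lecR ltW.
Qed.

Lemma Re_sigma (b : R) N (z : R[i]) : 0 < b -> (0 < N)%N -> b%:C < `|z| ->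
  0 < Re (sigma b N z).
Proof. by move=> b0 N0 bz; apply: Re_sub1_gt0; exact: norm_sigma_lt1. Qed.

Lemma hol_sigma b N (z : C) : z != 0 -> hol (sigma b N) z.
Proof.
move=> z0; apply: holB; first exact: hol_cst.
apply: holX; apply: holM; first exact: hol_cst.
by apply: holV => //; exact: hol_id.
Qed.

Definition eiR (t : R) : R[i] := cexp (0 +i* t).

Lemma eiRD s t : eiR (s + t) = eiR s * eiR t.
Proof. by rewrite /eiR -cexpD; congr cexp; apply/eqP; rewrite eq_complex /= addr0 !eqxx. Qed.

Lemma eiR_pow k t : eiR t ^+ k = eiR (k%:R * t).
Proof.
elim: k => [|k IH]; first by rewrite mul0r /eiR -[0 +i* 0]/(0 : R[i]) cexp0.
by rewrite exprS IH -eiRD mulrS mulrDl mul1r.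
Qed.

Lemma eiR_neq0 t : eiR t != 0.
Proof. exact: cexp_neq0. Qed.

Lemma norm_eiR t : `|eiR t| = 1.
Proof. by rewrite normc_cexp /= expR0. Qed.

Lemma eiRE t : eiR t = cos t +i* sin t.
Proof. by rewrite /eiR /cexp /= expR0 mul1r. Qed.

Lemma eiR_cts k (t : R) : {for t, continuous (fun t : R => eiR (k * t) : C)}.
Proof.
have -> : (fun t : R => eiR (k * t) : C) = (fun t => cos (k * t) +i* sin (k * t)).
  by apply/funext => s; exact: eiRE.
have ck : (fun s : R => k * s) @ t --> k * t.
  exact: (@cvgMr R _ _ (nbhs_filter t) _ _ _ (@cvg_id _ _)).
apply: (@cvgC _ _ _ (nbhs_filter t)) => /=.
  exact: (cvg_comp (fun s : R => k * s) cos ck (@continuous_cos R _)).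
exact: (cvg_comp (fun s : R => k * s) sin ck (@continuous_sin R _)).
Qed.

Lemma small_loopE (c lam : R[i]) t : small_loop c lam t = c + eiR (2 * pi * t) * (lam - c).
Proof. by []. Qed.

Lemma small_loop_cts (c lam : R[i]) (t : R) :
  {for t, continuous (small_loop c lam : R -> C)}.
Proof.
have h : (fun s : R => eiR (2 * pi * s) * (lam - c) : C) @ t --> (eiR (2 * pi * t) * (lam - c) : C).
  exact: (@cvgM C _ _ (nbhs_filter t) _ _ _ _ (@eiR_cts (2 * pi) t) (cvg_cst (lam - c : C))).
exact: (@cvgD _ C _ _ (nbhs_filter t) _ _ _ _ (cvg_cst (c : C)) h).
Qed.

(** Since c^N = b^N, sigma has a zero at c; it is simple because the cofactor takes the value N
    there. This lets fourth roots of sigma be built from those of z - c. *)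
Lemma sigma_factor (b : R) N (c z : R[i]) : c != 0 -> z != 0 -> c ^+ N = b%:C ^+ N ->
  sigma b N z = (z - c) / c * (c / z * \sum_(i < N) (c / z) ^+ i).
Proof.
move=> c0 z0 cN; rewrite /sigma exprMn -cN -exprMn.
rewrite -opprB subrX1 -mulNr opprB mulrA; congr (_ * _).
by field; rewrite c0 z0.
Qed.

(* Along the loop, [sigma] keeps the holomorphic fourth roots [r t], with
   [r 0 = root4 \o sigma] and [r 1 = 'i * r 0]; the function elements are
   [Phi \o r t]. *)
Lemma continuation_root4 (b rho : R) N (c : R[i]) : 0 < b -> (0 < N)%N -> 0 < rho ->
  c != 0 -> c ^+ N = b%:C ^+ N ->
  exists2 eta : R, 0 < eta & forall lam : R[i], `|lam - c| < eta%:C -> b%:C < `|lam| ->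
    forall Phi f g : C -> C,
    (forall r : C, 0 < `|r| < rho%:C -> hol Phi r) ->
    (\forall z \near (lam : C), f z = Phi (root4 (sigma b N z))) ->
    (\forall z \near (lam : C), g z = Phi ('i%C * root4 (sigma b N z))) ->
    analytic_continuation (small_loop c lam) f g.
Proof.
move=> b0 N0 rho0 c0 cN.
pose G (z : R[i]) : R[i] := c / z * \sum_(i < N) (c / z) ^+ i.
have holG (z : C) : z != 0 -> hol G z.
  move=> z0; have h : hol (fun z : C => c / z : C) z.
    by apply: holM; [exact: hol_cst|apply: holV => //; exact: hol_id].
  apply: holM; first exact: h.
  apply: hol_sum => i _.
  apply: holX.
  exact: h.
have Gc : G c = N%:R.
  rewrite /G divff // mul1r (eq_bigr (fun=> 1)) => [|i _]; last by rewrite expr1n.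
  by rewrite sumr_const card_ord.
have Gc0 : 0 < Re (G c).
  by rewrite Gc -(rmorph_nat (real_complex R)) /= ltr0n.
have sc : sigma b N c = 0.
  by rewrite (sigma_factor c0 c0 cN) subrr !mul0r.
have nG : \forall z \near (c : C), 0 < Re (G z) := hol_cts (holG _ c0) (near_Re_gt0 Gc0).
have nS : \forall z \near (c : C), `|sigma b N z| < (rho ^+ 4)%:C.
  have h : (sigma b N : C -> C) @ (c : C) --> (sigma b N c : C) := hol_cts (@hol_sigma b N c c0).
  rewrite sc in h.
  have : \forall x \near (0 : C), `|x| < (rho ^+ 4)%:C.
    by apply/nearC; exists (rho ^+ 4); [rewrite exprn_gt0|move=> x; rewrite subr0].
  exact: h.
have [eta eta0 heta] := (nearC _ _).1 (filterI (near_neq0 c0) (filterI nG nS)).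
(* Discs of radius |lam - c| about points of the loop lie within 2 |lam - c| of c, hence the
   half. *)
exists (eta / 2); first by rewrite divr_gt0.
move=> lam lc blam Phi f g hPhi hf hg.
have lc0 : lam - c != 0.
  rewrite subr_eq0; apply: contraTneq blam => ->.
  have : `|c| ^+ N = b%:C ^+ N.
    by rewrite -normrX cN normrX ger0_norm // ler0c ltW.
  move/(pexpIrn N0) => -> //; first by rewrite ltxx.
  by rewrite nnegrE ler0c ltW.
pose p t : R[i] := small_loop c lam t.
have pE t : p t - c = eiR (2 * pi * t) * (lam - c) by rewrite /p small_loopE addrC addKr.
have np t : `|p t - c| = `|lam - c| by rewrite pE normrM norm_eiR mul1r.
have pc0 t : p t - c != 0 by rewrite -normr_eq0 np normr_eq0.
have dlc : 0 < `|lam - c| by rewrite normr_gt0.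
(* The largest radius for which the disc about [p t] avoids c; on it (z - c) / (p t - c) stays in
   the right half-plane, so its principal root is available. *)
pose d : R := Re `|lam - c|.
have dE : d%:C = `|lam - c| by exact: Re_norm.
have good (t : R) (z : R[i]) : `|z - p t| < d%:C -> [/\ z != 0, 0 < Re (G z), `|sigma b N z| < (rho ^+ 4)%:C,
    z != c & 0 < Re ((z - c) / (p t - c))].
  move=> zp; have [|z0 [Gz Sz]] := heta z.
    rewrite (_ : z - c = (z - p t) + (p t - c)); last by rewrite addrA subrK.
    apply: le_lt_trans (ler_normD _ _) _; rewrite np.
    have -> : eta%:C = (eta / 2)%:C + (eta / 2)%:C by rewrite -rmorphD /=; congr (_ %:C); lra.
    by rewrite ltrD // (lt_trans zp) // dE.
  split => //.
    by apply: contraTneq zp => ->; rewrite distrC np dE ltxx.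
  rewrite (_ : _ / _ = 1 - (p t - z) / (p t - c)).
    by apply: Re_sub1_gt0; rewrite normrM normfV distrC np ltr_pdivrMr // mul1r -dE.
  by rewrite -{1}(divff (pc0 t)) -mulrBl; congr (_ / _); ring.
have Gl : 0 < Re (G lam).
  have [] := @good 0 lam; rewrite // /p small_loopE mulr0 /eiR cexp0 mul1r.
  by rewrite addrCA subrr addr0 subrr normr0 dE.
(* A continuous fourth root of (p t - c) / c; its argument grows by pi / 2 in one turn. The constant
   factor makes [r 0] agree with [root4] of sigma at lam. *)
pose a (t : R) : R[i] := eiR (pi / 2 * t) * (root4 (sigma b N lam) / root4 (G lam)).
have q0 (z : R[i]) : root4 z != 0 by exact: proot_neq0.
have a0 t : a t != 0 by rewrite /a mulf_neq0 ?eiR_neq0 // mulf_neq0 ?invr_eq0 ?q0.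
have lam0 : lam != 0 by apply: contraTneq blam => ->; rewrite normr0 ltcR lt_gtF.
have a4 t : a t ^+ 4 = (p t - c) / c.
  rewrite /a exprMn expr_div_n (root4_pow (Re_sigma b0 N0 blam)) (root4_pow Gl).
  rewrite (sigma_factor c0 lam0 cN) -/(G lam).
  rewrite mulfK; last exact: Re_gt0_neq0.
  rewrite eiR_pow pE (_ : 4%:R * (pi / 2 * t) = 2 * pi * t); first by rewrite mulrA.
  by rewrite -[4%:R]/(4 : R); field.
pose r t (z : R[i]) : R[i] := a t * (root4 ((z - c) / (p t - c)) * root4 (G z)).
have r4 (t : R) (z : R[i]) : `|z - p t| < d%:C -> r t z ^+ 4 = sigma b N z.
  move=> /good[z0 Gz _ _ zp].
  rewrite /r exprMn a4 exprMn (root4_pow zp) (root4_pow Gz).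
  rewrite (sigma_factor c0 z0 cN) -/(G z) mulrA; congr (_ * _).
  by rewrite mulrC mulrA divfK.
have r0 (t : R) (z : R[i]) : r t z != 0 by exact: mulf_neq0 (a0 t) (mulf_neq0 (q0 _) (q0 _)).
have holr t (z : C) : `|z - p t| < d%:C -> hol (r t) z.
  move=> /good[z0 Gz _ _ zp].
  apply: holM; first exact: hol_cst.
  apply: holM.
    apply: (@hol_comp R root4 (fun z : C => (z - c) / (p t - c))).
      apply: holM; last exact: hol_cst.
      apply: holB; [exact: hol_id|exact: hol_cst].
    exact: hol_root4.
  apply: (@hol_comp R root4 G); first exact: holG.
  exact: hol_root4.
have d0 : 0 < d by rewrite -ltcR dE.
have ndisc (t : R) (z : C) : `|z - p t| < d%:C -> \forall x \near z, `|x - p t| < d%:C.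
  move=> zp; apply/nearC; exists (d - Re `|z - p t|); first by rewrite subr_gt0 -ltcR Re_norm.
  move=> x; rewrite rmorphB /= Re_norm ltrBrDr => h; apply: le_lt_trans h.
  by rewrite -(subrKA z x); exact: ler_normD.
have center (t : R) : `|p t - p t| < d%:C by rewrite subrr normr0 ltcR.
have p0 : p 0 = lam by rewrite /p small_loopE mulr0 /eiR cexp0 mul1r addrC subrK.
have p1 : p 1 = lam.
  by rewrite /p small_loopE mulr1 eiRE mulr2n mulrDl mul1r cos2pi sin2pi mul1r addrC subrK.
have rc (t : R) : r t (p t) = a t * root4 (G (p t)).
  by rewrite /r divff // /root4 !proot1 mul1r.
have start : \forall z \near (lam : C), r 0 z = root4 (sigma b N z).
  have h1 : {for (lam : C), continuous (r 0 : C -> C)}.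
    by apply: hol_cts; apply: holr; rewrite p0 subrr normr0 ltcR.
  have h2 : hol (root4 \o sigma b N) lam.
    by apply: hol_comp; [exact: hol_sigma|apply: hol_root4; exact: Re_sigma].
  have q : r 0 lam = (root4 \o sigma b N) lam.
    rewrite -[X in r 0 X]p0 rc p0 /a mulr0 /eiR cexp0 mul1r divfK //.
  apply: (pow_eq_cts (isT : 0 < 4)%N h1 (hol_cts h2) q (q0 _)).
  have n1 : \forall z \near (lam : C), 0 < Re (sigma b N z).
    have hs : {for (lam : C), continuous (sigma b N : C -> C)} by apply: hol_cts; exact: hol_sigma.
    exact: (hs _ (near_Re_gt0 (Re_sigma b0 N0 blam))).
  have n2 : \forall z \near (lam : C), `|z - p 0| < d%:C by apply: ndisc; rewrite p0 subrr normr0 ltcR.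
  by apply: filterS2 n1 n2 => z z1 z2; rewrite (r4 _ _ z2) /= root4_pow.
have turn (z : R[i]) : r 1 z = 'i%C * r 0 z.
  rewrite /r p0 p1 /a !mulr1 mulr0 eiRE cos_pihalf sin_pihalf /eiR cexp0 mul1r.
  exact: (esym (mulrA _ _ _)).
have nloop (t : R) : \forall u \near t, `|p u - p t| < d%:C.
  exact: (@small_loop_cts c lam t _ (ndisc _ _ (center t))).
(* Both sides are fourth roots of (p u - c) / c, and their ratio tends to 1 as u tends to t. *)
have transport (t : R) : \forall u \near t, a u = a t * root4 ((p u - c) / (p t - c)).
  pose g0 (u : R) : R[i] := a t * root4 ((p u - c) / (p t - c)).
  have cp : (fun u => (p u - c) / (p t - c) : C) @ t --> (1 : C).
    have h1 : (fun u => p u - c : C) @ t --> (p t - c : C).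
      exact: (@cvgB _ C _ _ (nbhs_filter t) _ _ _ _ (@small_loop_cts c lam t) (cvg_cst (c : C))).
    have h2 := @cvgM C _ _ (nbhs_filter t) _ _ _ _ h1 (cvg_cst ((p t - c)^-1 : C)).
    by rewrite (divff (pc0 t)) in h2; exact: h2.
  have cr : (fun u => root4 ((p u - c) / (p t - c)) : C) @ t --> (1 : C).
    have h1 : (0 : R) < Re (1 : R[i]) by rewrite /= ltr01.
    have := cvg_comp (fun u : R => (p u - c) / (p t - c) : C) root4 cp (hol_cts (hol_root4 h1)).
    by rewrite /root4 !proot1; apply.
  have ca : (fun u => a u : C) @ t --> (a t : C).
    exact: (@cvgM C _ _ (nbhs_filter t) _ _ _ _ (@eiR_cts (pi / 2) t) (cvg_cst _)).
  have cg : (fun u => g0 u : C) @ t --> (a t : C).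
    have := @cvgM C _ _ (nbhs_filter t) _ _ _ _ (cvg_cst (a t : C)) cr.
    by rewrite mulr1; apply.
  have cfg : (fun u => a u / g0 u : C) @ t --> (1 : C).
    have := @cvgM C _ _ (nbhs_filter t) _ _ _ _ ca (@cvgV C _ _ (nbhs_filter t) _ _ (a0 t) cg).
    by rewrite (divff (a0 t)); apply.
  apply: (@pow_eq_near R R (nbhs t) (nbhs_filter t) 4 a g0 isT cfg).
    by apply: filterE => u; exact: mulf_neq0 (a0 t) (q0 _).
  apply: filterS (nloop t) => u /good[_ _ _ _ up].
  by rewrite (a4 u) /g0 exprMn (a4 t) (root4_pow up) [RHS]mulrC mulrA (divfK (pc0 t)).
exists (fun=> d), (fun t => Phi \o r t); split.
- move=> t _; split=> // z zt.
  apply: (@hol_comp R Phi (r t)); first exact: holr.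
  apply: hPhi; rewrite normr_gt0 r0 /=.
  (* |r|^4 = |sigma| < rho^4 keeps the values of [r t] in the disc where Phi is holomorphic. *)
  have := congr1 Num.norm (r4 _ _ zt); rewrite normrX => e.
  have [_ _ + _ _] := good _ _ zt; rewrite -e rmorphXn /=.
  by rewrite ltr_pXn2r ?nnegrE ?normr_ge0 // ler0c ltW.
- rewrite -/(p 0) p0; apply: filterS2 start hf => z /= e1 ->.
  by rewrite e1.
- rewrite -/(p 1) p1; apply: filterS2 start hg => z /= e1 ->.
  by rewrite turn e1.
- move=> t _.
  have [e /= e0 he] := (nbhs_ballP _ _).1 (filterI (nloop t) (transport t)).
  exists e => // u _ ut.
  have [up ua] : `|p u - p t| < d%:C /\ a u = a t * root4 ((p u - c) / (p t - c)).
    by apply: he; rewrite /ball /= distrC.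
  split; first exact: up.
  (* By [transport], [r u] and [r t] agree at [p u]; both are continuous fourth roots of sigma, so
     they agree near [p u]. *)
  suff : \forall z \near (p u : C), r u z = r t z by apply: filterS => z /= ->.
  have q : r u (p u) = r t (p u) by rewrite rc /r ua mulrA.
  apply: (pow_eq_cts (isT : 0 < 4)%N (hol_cts (holr _ _ (center u))) (hol_cts (holr _ _ up)) q (r0 _ _)).
  by apply: filterS2 (ndisc _ _ (center u)) (ndisc _ _ up) => z z1 z2; rewrite !r4.
Qed.

End Continuation.

(** * The monodromy matrix *)

Section MonodromyMatrix.
Variable R : realType.

Lemma ord_gt0 p (j : 'I_p) : (0 < p)%N.
Proof. exact: leq_ltn_trans (leq0n j) (ltn_ord j). Qed.

(* The sheet that the loop around [branch_point n] exchanges with sheet [j]. *)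
Definition reflect_ord (p n : nat) (j : 'I_p) : 'I_p :=
  Ordinal (ltn_pmod (n + (p - j)) (ord_gt0 j)).

Lemma reflect_ordP (p n : nat) (j l : 'I_p) :
  (j + l == n %[mod p])%N = (l == reflect_ord n j).
Proof.
have jp := ltnW (ltn_ord j).
apply/idP/idP => [/eqP e|/eqP ->].
  apply/eqP/val_inj; rewrite /= -(modn_small (ltn_ord l)); apply/eqP.
  rewrite -(eqn_modDl j) addnCA subnKC // addnC -[in X in _ == X]addnC.
  by rewrite modnDl addnC e.
by rewrite /= modnDmr addnCA subnKC // modnDr.
Qed.

Lemma reflect_ordK (p n : nat) : involutive (@reflect_ord p n).
Proof. by move=> j; apply/esym/eqP; rewrite -reflect_ordP addnC reflect_ordP. Qed.

(** The only nonzero entry of column j of the monodromy matrix, in row [reflect_ord n j]. It is 1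
    for a fixed sheet, whose column no factor touches. *)
Definition exchange_coef (p n : nat) (j : 'I_p) : R[i] :=
  if reflect_ord n j == j then 1
  else if (j < reflect_ord n j)%N then omega_pow p (- ((reflect_ord n j)%:R - j%:R) / 2)
  else - (omega_pow p (- (j%:R - (reflect_ord n j)%:R) / 2))^-1.

Lemma exchange_mxE p (l j a b : 'I_p) (alpha : R[i]) : l != j ->
  exchange_mx l j alpha a b =
    if b == j then alpha *+ (a == l)
    else if b == l then - alpha^-1 *+ (a == j) else (a == b)%:R.
Proof.
move=> lj; rewrite /exchange_mx !mxE.
case: (eqVneq b j) => [->|bj].
  rewrite (eq_sym j l) (negPf lj) !andbT !andbF mulr0 !subr0 mulr_natr.
  by rewrite [X in X - _]addrC addrK.
case: (eqVneq b l) => [->|bl].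
  rewrite !andbT !andbF mulr0 addr0 subr0 mulr_natr.
  by rewrite [X in X - _]addrC addrK mulNrn.
by rewrite !andbF !mulr0 addr0 !subr0.
Qed.

(** A partial product is monomial: column b has been exchanged exactly when b belongs to one of the
    pairs already multiplied in. *)
Lemma exchange_prodE (p n : nat) (r : seq ('I_p * 'I_p)) (a b : 'I_p) :
  uniq r ->
  all (fun jl : 'I_p * 'I_p => (jl.1 < jl.2)%N && (jl.2 == reflect_ord n jl.1)) r ->
  (\big[mulmx/1%:M]_(jl <- r)
      exchange_mx jl.2 jl.1 (omega_pow p (- ((jl.2)%:R - (jl.1)%:R) / 2))) a b =
  if has (fun jl => (b == jl.1) || (b == jl.2)) r
  then exchange_coef n b *+ (a == reflect_ord n b) else (a == b)%:R :> R[i].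
Proof.
elim: r a b => [|[j l] r IH] a b /=; first by rewrite big_nil mxE.
move=> /andP[jlr ur] /andP[/andP[jl /eqP el] ar].
have lj : l != j by rewrite -val_eqE /= gtn_eqF.
have sl : reflect_ord n l = j by rewrite el reflect_ordK.
rewrite big_cons mxE.
rewrite (eq_bigr _ (fun c _ => congr1 (fun x => exchange_mx l j _ a c * x) (IH c b ur ar))).
(* Either member of a pair determines the other through [reflect_ord], and the order decides which
   comes first; so distinct pairs are disjoint. *)
have fresh : has (fun jl0 => (b == jl0.1) || (b == jl0.2)) r -> (b != j) && (b != l).
  move=> /hasP[[j' l'] r' /= bj']; have /allP/(_ _ r')/andP[/= jl' /eqP el'] := ar.
  apply/andP; split; apply: contraNneq jlr => e; subst b.
    case/orP : bj' => /eqP e; first by rewrite el e -el'.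
    have ej' : j' = l by rewrite -(reflect_ordK n j') -el' -e.
    by move: jl'; rewrite ej' -e ltnNge ltnW.
  case/orP : bj' => /eqP e; last by rewrite -sl e el' reflect_ordK -el'.
  by move: jl'; rewrite el' -e sl ltnNge ltnW.
case hb : (has _ r).
  have /andP[bj bl] := fresh hb.
  rewrite (bigD1 (reflect_ord n b)) //= big1 => [|i ib]; last by rewrite (negPf ib) mulr0.
  rewrite eqxx addr0 exchange_mxE // orbT.
  have -> : (reflect_ord n b == j) = false.
    by apply/negbTE; apply: contraNneq bl => e; rewrite el -e reflect_ordK.
  have -> : (reflect_ord n b == l) = false.
    by apply/negbTE; apply: contraNneq bj => e; rewrite -sl -e reflect_ordK.
  by rewrite mulr1n mulr_natl.
rewrite (bigD1 b) //= big1 => [|i ib]; last by rewrite (negPf ib) mulr0.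
rewrite eqxx mulr1 addr0 exchange_mxE // orbF.
case: (eqVneq b j) => [->|bj] /=.
  by rewrite /exchange_coef -!el (negPf lj) jl.
case: (eqVneq b l) => [->|bl] //=.
by rewrite /exchange_coef !sl (eq_sym j l) (negPf lj) ltnNge ltnW.
Qed.

Lemma monodromy_mxE (p n : nat) (a b : 'I_p) :
  monodromy_mx R p n a b = exchange_coef n b *+ (a == reflect_ord n b).
Proof.
rewrite /monodromy_mx -big_filter; set r := [seq _ <- _ | _].
have ar : all (fun jl : 'I_p * 'I_p => (jl.1 < jl.2)%N && (jl.2 == reflect_ord n jl.1)) r.
  by apply/allP => jl; rewrite mem_filter reflect_ordP => /andP[].
rewrite (exchange_prodE _ _ _ ar); last by rewrite filter_uniq // index_enum_uniq.
case: ifP => // /hasP nb.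
(* An index b moved by the reflection would occur in the list, paired with its image in increasing
   order. *)
have sbb : reflect_ord n b = b; last by rewrite /exchange_coef sbb eqxx.
apply/eqP; apply: contra_notT nb => sb.
have [bs|] := ltnP b (reflect_ord n b).
  exists (b, reflect_ord n b); last by rewrite /= eqxx.
  have e : (b + reflect_ord n b == n %[mod p])%N by rewrite reflect_ordP.
  by rewrite mem_filter mem_index_enum andbT; apply/andP; split; [exact: bs|exact: e].
rewrite leq_eqVlt val_eqE (negPf sb) /= => bs.
exists (reflect_ord n b, b); last by rewrite /= eqxx orbT.
have e : (reflect_ord n b + b == n %[mod p])%N by rewrite reflect_ordP reflect_ordK.
by rewrite mem_filter mem_index_enum andbT; apply/andP; split; [exact: bs|exact: e].
Qed.

Lemma exchange_coef_neq0 p n (j : 'I_p) : exchange_coef n j != 0.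
Proof.
rewrite /exchange_coef; case: ifP => _; first exact: oner_neq0.
by case: ifP => _; rewrite ?oppr_eq0 ?invr_eq0 cexp_neq0.
Qed.

Lemma monodromy_mx_unit p n : monodromy_mx R p n \in unitmx.
Proof.
(* The inverse of a monomial matrix is its transpose with inverted nonzero entries. *)
pose M' : 'M[R[i]]_p := \matrix_(j, i) ((exchange_coef n j)^-1 *+ (i == reflect_ord n j)).
suff /mulmx1_unit[] : M' *m monodromy_mx R p n = 1%:M by [].
apply/matrixP => j k; rewrite !mxE.
under eq_bigr do rewrite mxE monodromy_mxE.
rewrite (bigD1 (reflect_ord n j)) //= big1 => [|i ij]; last by rewrite (negPf ij) mul0r.
rewrite eqxx addr0 mulr1n (inj_eq (inv_inj (@reflect_ordK p n))).
by case: eqP => [->|_]; rewrite ?mulVf ?exchange_coef_neq0 // mulr0n mulr0.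
Qed.

Lemma conj_monodromy_mx p n (d : 'I_p -> R[i]) :
  invmx (monodromy_mx R p n) *m diag_mx (\row_j d j) *m monodromy_mx R p n =
  diag_mx (\row_j d (reflect_ord n j)).
Proof.
(* In the form D M = M D' the identity can be compared entrywise. *)
rewrite -mulmxA; apply: (canLR (mulKmx (monodromy_mx_unit p n))).
apply/matrixP => a b; rewrite mul_diag_mx mul_mx_diag !mxE !monodromy_mxE.
by case: eqP => [->|_]; rewrite ?mulr0n ?mulr0 ?mul0r // mulrC.
Qed.

Lemma mul_monodromy_mx p n m (A : 'M[R[i]]_(m, p)) a b :
  (A *m monodromy_mx R p n) a b = A a (reflect_ord n b) * exchange_coef n b.
Proof.
rewrite mxE (bigD1 (reflect_ord n b)) //= big1 => [|i ib].
  by rewrite monodromy_mxE eqxx addr0.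
by rewrite monodromy_mxE (negPf ib) mulr0n mulr0.
Qed.

End MonodromyMatrix.

(** * Roots of unity *)

Section RootsOfUnity.
Variable R : realType.
Local Notation C := (R[i]^o).

Lemma Re_inv_gt0 (x : R[i]) : 0 < Re x -> 0 < Re x^-1.
Proof.
case: x => a b /= a0; apply: divr_gt0 => //.
by rewrite ltr_pwDl ?exprn_gt0 ?sqr_ge0.
Qed.

Variable p : nat.
Hypothesis p_gt0 : (0 < p)%N.
Local Notation om := (@omega_pow R p).

Lemma omE x : om x = eiR (2 * pi * x / p%:R). Proof. by []. Qed.

Lemma om0 : om 0 = 1.
Proof. by rewrite omE mulr0 mul0r /eiR cexp0. Qed.

Lemma omD x y : om (x + y) = om x * om y.
Proof. by rewrite !omE -eiRD; congr eiR; rewrite mulrDr mulrDl. Qed.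

Lemma om_neq0 x : om x != 0. Proof. exact: cexp_neq0. Qed.

Lemma omN x : om (- x) = (om x)^-1.
Proof. by apply: (mulIf (om_neq0 x)); rewrite -omD addNr om0 mulVf ?om_neq0. Qed.

Lemma norm_om x : `|om x| = 1. Proof. exact: norm_eiR. Qed.

Lemma om_pow k x : om x ^+ k = om (k%:R * x).
Proof. by rewrite !omE eiR_pow; congr eiR; rewrite !mulrA; congr (_ / _); ring. Qed.

Lemma omp k : om (k%:R * p%:R) = 1.
Proof.
rewrite -om_pow omE mulfK ?pnatr_eq0 -?lt0n // eiRE mulr2n mulrDl mul1r.
by rewrite cos2pi sin2pi expr1n.
Qed.

Lemma om_eq_mod (k l : nat) : (k = l %[mod p])%N -> om k%:R = om l%:R.
Proof.
move=> e; rewrite (divn_eq k p) (divn_eq l p) e !natrD !omD !natrM !omp //.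
Qed.

(** After reduction to k < p, a nonzero k would give cos (2 pi t) = 1 with 0 < t < 1, against sin
    (pi t) > 0. *)
Lemma om_eq1 (k : nat) : om k%:R = 1 -> (p %| k)%N.
Proof.
rewrite (om_eq_mod (esym (modn_mod k p))) /dvdn; have := ltn_pmod k p_gt0.
move: (k %% p)%N => {}k kp; rewrite omE eiRE => -[cos1 _].
apply: contraT => k0.
have : 0 < (k%:R / p%:R : R) < 1.
  apply/andP; split; first by apply: divr_gt0; rewrite ltr0n // lt0n.
  by rewrite ltr_pdivrMr ?ltr0n // mul1r ltr_nat.
set t : R := k%:R / p%:R => /andP[t0 t1].
have st : 0 < sin (pi * t).
  by apply: sin_gt0_pi; rewrite mulr_gt0 ?pi_gt0 //= gtr_pMr ?pi_gt0.
move: cos1; rewrite -mulrA -/t -mulrA mulr_natl cos_mulr2n.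
have := cos2Dsin2 (pi * t); nra.
Qed.

Lemma Re_1sub (z : R[i]) : `|z| = 1 -> z != 1 -> 0 < Re (1 - z).
Proof.
case: z => a b z1 zn1.
have e : a ^+ 2 + b ^+ 2 = 1.
  by have /(congr1 (@complex.Re R)) := add_Re2_Im2 (a +i* b); rewrite z1 expr1n.
rewrite /= subr_gt0 lt_neqAle; apply/andP; split; last by nra.
apply: contra zn1 => /eqP a1; rewrite eq_complex /= a1 eqxx /=.
by move: e; rewrite a1 expr1n => /eqP; rewrite addrC -subr_eq0 addrK sqrf_eq0.
Qed.

(* The factor of [unifE zeta] under [r |-> 'i * r], apart from [unifV]; at
   [zeta = 1] it is the turn of a fourth root. *)
Definition turn_coef (z : R[i]) : R[i] :=
  if z == 1 then 'i%C else proot 2 (1 - z) / proot 2 (1 - z^-1).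

Lemma normV1 (z : R[i]) : `|z| = 1 -> `|z^-1| = 1.
Proof. by move=> z1; rewrite normfV z1 invr1. Qed.

Lemma turn_coefV (z : R[i]) : turn_coef z * turn_coef z^-1 = if z == 1 then -1 else 1.
Proof.
rewrite /turn_coef invr_eq1 invrK; case: ifP => _; first by rewrite -expr2 sqr_i.
by rewrite mulrA divfK ?divff // proot_neq0.
Qed.

(** Because (1 - z) / (1 - 1 / z) = - z. *)
Lemma turn_coef_sqr (z : R[i]) : `|z| = 1 -> z != 1 -> turn_coef z ^+ 2 = - z.
Proof.
move=> z1 zn1; have z0 : z != 0 by rewrite -normr_eq0 z1 oner_neq0.
rewrite /turn_coef (negPf zn1) expr_div_n !proot_pow //.
- by field; rewrite z0 subr_eq0 zn1.
- by apply: Re_1sub; rewrite ?normV1 ?invr_eq1.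
- exact: Re_1sub.
Qed.

Lemma Re_turn_coef (z : R[i]) : `|z| = 1 -> z != 1 -> 0 < Re (turn_coef z).
Proof.
move=> z1 zn1; rewrite /turn_coef (negPf zn1); apply: sectorM.
  by apply: sector_proot2; exact: Re_1sub.
by apply: sectorV; apply: sector_proot2; apply: Re_1sub; rewrite ?normV1 ?invr_eq1.
Qed.

(** Both sides have the same square, and both have positive real part, which on the right is sin (pi
    d / p). The half-integral powers of omega in the monodromy matrix come from here. *)
Lemma turn_coef_om (d : nat) : (0 < d < p)%N -> turn_coef (om (- d%:R)) = 'i%C * om (- d%:R / 2).
Proof.
move=> /andP[d0 dp].
have d1 : om (- d%:R) != 1.
  rewrite omN invr_eq1; by apply/eqP => /om_eq1 pd; have := dvdn_leq d0 pd; rewrite leqNgt dp.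
apply: sqr_inj_Re; first by apply: Re_turn_coef; rewrite ?norm_om.
  rewrite mulrC ReiNIm omE eiRE /= -sinN.
  have -> : - (2 * pi * (- d%:R / 2) / p%:R) = pi * (d%:R / p%:R) :> R.
    by field; rewrite pnatr_eq0 -lt0n.
  apply: sin_gt0_pi; rewrite mulr_gt0 ?pi_gt0 ?divr_gt0 ?ltr0n //=.
  by rewrite gtr_pMr ?pi_gt0 // ltr_pdivrMr ?ltr0n // mul1r ltr_nat.
rewrite turn_coef_sqr ?norm_om // exprMn sqr_i om_pow mulN1r; congr (- om _).
by field.
Qed.

End RootsOfUnity.

(** * Gaps between sheets and the product of the branch constants *)

Section TurnCoef.
Variable R : realType.
Variable p n : nat.
Hypothesis p_gt0 : (0 < p)%N.
Local Notation om := (@omega_pow R p).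

(** The zeta attached to the pair (j, a): with exp tau = omega^(n/2) V, the radicand 1 - omega^(j +
    a) exp(-2 tau) becomes 1 - zeta / V^2. *)
Definition gap (j a : 'I_p) : R[i] := om (j%:R + a%:R - n%:R).

Lemma gap_eq1 j a : (gap j a == 1) = (a == reflect_ord n j).
Proof.
rewrite -reflect_ordP /gap omD omN.
have -> : om (j%:R + a%:R) = om (j + a)%:R by rewrite natrD.
apply/eqP/eqP => [e|/(om_eq_mod R p_gt0) ->]; last by rewrite mulfV ?om_neq0.
have {}e : om (j + a)%:R = om n%:R.
  by move/(canRL (mulfVK (om_neq0 _ _))) : e; rewrite mul1r.
have [h|/ltnW h] := leqP n (j + a).
  apply/eqP; rewrite eqn_mod_dvd //; apply: (@om_eq1 R) => //.
  by rewrite natrB // omD omN e mulfV ?om_neq0.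
apply/esym/eqP; rewrite eqn_mod_dvd //; apply: (@om_eq1 R) => //.
by rewrite natrB // omD omN e mulfV ?om_neq0.
Qed.

(** The reflection is k to n - k modulo p, so the exponent j + a - n changes sign. *)
Lemma gap_reflect j a : gap (reflect_ord n j) (reflect_ord n a) = (gap j a)^-1.
Proof.
have h (k : 'I_p) : om (reflect_ord n k)%:R = om (n%:R - k%:R).
  apply: (mulIf (om_neq0 p (k%:R : R))); rewrite -!omD subrK -natrD.
  by apply: om_eq_mod => //; apply/eqP; rewrite reflect_ordP reflect_ordK.
rewrite /gap -omN omD omD !h -!omD; congr (om _); ring.
Qed.

Lemma norm_gap j a : `|gap j a| = 1. Proof. exact: norm_om. Qed.

Lemma prod_turn_coef j : \prod_(a < p) turn_coef (gap j a) = 'i%C.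
Proof.
rewrite (bigD1 (reflect_ord n j)) //=.
have -> : gap j (reflect_ord n j) = 1 by apply/eqP; rewrite gap_eq1.
rewrite {1}/turn_coef eqxx -[RHS]mulr1; congr (_ * _).
(* The involution a to 2 (n - j) - a modulo p, which inverts the gap; n + (p - j) avoids a truncated
   difference. *)
pose m (a : 'I_p) := reflect_ord (2 * (n + (p - j)))%N a.
have mK : involutive m := reflect_ordK _.
have gm a : gap j (m a) = (gap j a)^-1.
  apply: (mulIf (_ : gap j a != 0)); first exact: om_neq0.
  rewrite mulVf ?om_neq0 // /gap -omD.
  have -> : j%:R + (m a)%:R - n%:R + (j%:R + a%:R - n%:R) =
    (m a + a)%:R - (2 * (n + (p - j)))%:R + 2%:R * p%:R :> R.
    by rewrite natrM !natrD natrB ?(ltnW (ltn_ord j)) //; ring.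
  rewrite omD omp // mulr1 omD omN (@om_eq_mod R p p_gt0 (m a + a) (2 * (n + (p - j)))).
    by rewrite mulfV ?om_neq0.
  by apply/eqP; rewrite reflect_ordP reflect_ordK.
rewrite (eq_bigl (fun a => gap j a != 1)) => [|a]; last by rewrite gap_eq1.
rewrite (eq_bigr (fun a => proot 2 (1 - gap j a) / proot 2 (1 - (gap j a)^-1))) => [|a /negPf h].
  (* Reindexing the numerators by m turns them into the denominators; this also covers zeta = -1,
     which is its own inverse. *)
  rewrite big_split /= (reindex_inj (inv_inj mK)) /= prodfV.
  rewrite (eq_bigl (fun a => gap j a != 1)) => [|a]; last by rewrite gm invr_eq1.
  rewrite (eq_bigr (fun a => proot 2 (1 - (gap j a)^-1))) => [|a _]; last by rewrite gm.
  by rewrite mulfV //; apply/prodf_neq0 => a _; exact: proot_neq0.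
by rewrite /turn_coef h.
Qed.

(** The product in [sqrt_Delta] omits a = j. Dividing the full product i by this omitted factor
    leaves the inverse of [exchange_coef]. *)
Lemma turn_coef_exchange j : turn_coef (gap j j) = 'i%C * exchange_coef R n j.
Proof.
set l := reflect_ord n j.
have e : gap j j = om (j%:R - l%:R).
  have h : om l%:R = om (n%:R - j%:R).
    apply: (mulIf (om_neq0 p (j%:R : R))); rewrite -!omD subrK -natrD.
    by apply: om_eq_mod => //; apply/eqP; rewrite reflect_ordP reflect_ordK.
  rewrite /gap [RHS]omD omN h -omN -omD; congr (om _); ring.
rewrite /exchange_coef -/l.
have [lj|lj] := eqVneq l j.
  by rewrite e lj subrr om0 /turn_coef eqxx mulr1.
have pos (a b : 'I_p) : (a < b)%N -> (0 < b - a < p)%N.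
  by move=> ab; rewrite subn_gt0 ab (leq_ltn_trans (leq_subr _ _)).
case: ifP => [jl|/negbT].
  have -> : gap j j = om (- (l - j)%:R) by rewrite e natrB ?(ltnW jl) // opprB.
  by rewrite turn_coef_om ?pos // natrB // ltnW.
rewrite -leqNgt leq_eqVlt val_eqE (negPf lj) /= => lj'.
(* Now j - l is positive, so [turn_coef_om] applies to the inverse gap, and [turn_coefV] returns to
   the gap itself. *)
have ej : (gap j j)^-1 = om (- (j - l)%:R).
  by rewrite e -omN natrB // ltnW.
have g1 : (gap j j)^-1 == 1 = false.
  by rewrite invr_eq1 gap_eq1 eq_sym; apply/negbTE.
have := turn_coefV ((gap j j)^-1).
rewrite g1 invrK {1}ej turn_coef_om ?pos // natrB ?(ltnW lj') // => h.
have i0 : 'i%C != 0 :> R[i] by rewrite -normr_eq0 normCE /= expr0n add0r expr1n sqrtr1 oner_neq0.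
apply: (mulfI (mulf_neq0 i0 (om_neq0 p (- (j%:R - l%:R) / 2)))).
rewrite h mulrN mulrN -mulrA [om _ * _]mulrC mulfVK ?om_neq0 //.
by rewrite -expr2 sqr_i opprK.
Qed.

End TurnCoef.

(** * The local uniformization *)

Lemma sum_exprM_rev (K : comNzRingType) (x y : K) p :
  \sum_(k < p) x ^+ (p.-1 - k) * y ^+ k = \sum_(k < p) y ^+ (p.-1 - k) * x ^+ k.
Proof.
rewrite (reindex_inj rev_ord_inj) /=; apply: eq_bigr => k _.
have -> : (p - k.+1 = p.-1 - k)%N by rewrite -subn1 -subnDA add1n.
have kp : (k <= p.-1)%N by rewrite -ltnS (ltn_predK (ltn_ord k)).
by rewrite (subKn kp); exact: mulrC.
Qed.

Section Uniformized.
Variable R : realType.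
Local Notation C := (R[i]^o).
Variable p : nat.
Hypothesis p_gt0 : (0 < p)%N.

(* With [s] the square root of [sigma], these are [b exp tau / z] (unifA),
   [omega ^ (- n / 2) exp tau] (unifV), the common factor of all square-root
   factors (unifS) and, at [s = r ^ 2], the principal root of
   [1 - zeta / unifV s ^ 2] (unifE); for [zeta = 1] the radicand is [s * unifB s],
   so that the root ramifies in [s] but not in [r]. *)
Definition unifA (s : R[i]) : R[i] := proot p (1 + s).
Definition unifV (s : R[i]) : R[i] := proot 2 (unifA s / unifA (- s)).
Definition unifB (s : R[i]) : R[i] :=
  2 / (unifA s * \sum_(k < p) unifA s ^+ (p.-1 - k) * unifA (- s) ^+ k).
Definition unifS (c2 : R) (s : R[i]) : R[i] := proot 2 (c2%:C * unifA s).
Definition unifE (zeta r : R[i]) : R[i] :=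
  if zeta == 1 then r * proot 2 (unifB (r ^+ 2))
  else proot 2 (1 - zeta / unifV (r ^+ 2) ^+ 2).

(** Symmetric under s to - s, and keeps every radicand in the right half-plane. *)
Definition regular (s : R[i]) : Prop :=
  [/\ 0 < Re (1 + s), 0 < Re (1 - s), 0 < Re (unifA s / unifA (- s)), 0 < Re (unifB s)
    & 0 < Re (unifB (- s))].

Lemma unifA_neq0 s : unifA s != 0. Proof. exact: proot_neq0. Qed.
Lemma unifV_neq0 s : unifV s != 0. Proof. exact: proot_neq0. Qed.

Lemma regularN s : regular s -> regular (- s).
Proof.
move=> [h1 h2 h3 h4 h5]; split; rewrite ?opprK //.
by rewrite -invf_div; exact: Re_inv_gt0.
Qed.

Lemma unifA_pow s : 0 < Re (1 + s) -> unifA s ^+ p = 1 + s.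
Proof. exact: proot_pow. Qed.

Lemma hol_unifA (s : C) : 0 < Re (1 + s) -> hol unifA s.
Proof.
move=> h; apply: (@hol_comp R (proot p) (fun s : C => 1 + s)); last exact: hol_proot.
by apply: holD; [exact: hol_cst|exact: hol_id].
Qed.

Lemma hol_unifAN (s : C) : 0 < Re (1 - s) -> hol (fun s => unifA (- s)) s.
Proof.
move=> h; apply: (@hol_comp R unifA (fun s : C => - s)); last exact: hol_unifA.
by apply: holN; exact: hol_id.
Qed.

Lemma hol_ratio (s : C) : 0 < Re (1 + s) -> 0 < Re (1 - s) ->
  hol (fun s => unifA s / unifA (- s)) s.
Proof.
move=> h1 h2; apply: holM; first exact: hol_unifA.
by apply: holV; [exact: hol_unifAN|exact: unifA_neq0].
Qed.

(** If the sum vanished, [unifB s] would be 0, since the inverse of 0 is 0. *)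
Lemma sumA_neq0 (s : R[i]) : 0 < Re (unifB s) ->
  \sum_(k < p) unifA s ^+ (p.-1 - k) * unifA (- s) ^+ k != 0.
Proof.
move/Re_gt0_neq0; apply: contraNneq => e.
by rewrite /unifB e mulr0 invr0 mulr0.
Qed.

Lemma hol_unifB (s : C) : 0 < Re (1 + s) -> 0 < Re (1 - s) ->
  \sum_(k < p) unifA s ^+ (p.-1 - k) * unifA (- s) ^+ k != 0 -> hol unifB s.
Proof.
move=> h1 h2 h3; apply: holM; first exact: hol_cst.
apply: holV; last by rewrite mulf_neq0 ?unifA_neq0.
apply: holM; first exact: hol_unifA.
apply: hol_sum => k _; apply: holM; apply: holX; first exact: hol_unifA.
exact: hol_unifAN.
Qed.

Lemma hol_unifV (s : C) : regular s -> hol unifV s.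
Proof.
move=> [h1 h2 h3 _ _].
apply: (@hol_comp R (proot 2) (fun s => unifA s / unifA (- s))); last exact: hol_proot.
exact: hol_ratio.
Qed.

Lemma unifA0 : unifA 0 = 1.
Proof. by rewrite /unifA addr0 proot1. Qed.

Lemma unifV0 : unifV 0 = 1.
Proof. by rewrite /unifV oppr0 unifA0 divr1 proot1. Qed.

Lemma unifB0 : unifB 0 = 2 / p%:R.
Proof.
rewrite /unifB oppr0 unifA0 mul1r (eq_bigr (fun=> 1)) => [|i _]; last by rewrite !expr1n mulr1.
by rewrite sumr_const card_ord.
Qed.

Lemma near0N (P : C -> Prop) : (\forall s \near (0 : C), P s) -> \forall s \near (0 : C), P (- s).
Proof.
move=> /nearC[e e0 h]; apply/nearC; exists e => // x.
by rewrite subr0 => xe; apply: h; rewrite subr0 normrN.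
Qed.

Lemma near_Re_hol (f : C -> C) (z : C) : hol f z -> 0 < Re (f z) -> \forall x \near z, 0 < Re (f x).
Proof. by move=> /hol_cts fc h; exact: (fc _ (near_Re_gt0 h)). Qed.

Lemma near_regular : \forall s \near (0 : C), regular s.
Proof.
have R1 : 0 < Re (1 + 0 : R[i]) by rewrite addr0 /= ltr01.
have R1' : 0 < Re (1 - 0 : R[i]) by rewrite subr0 /= ltr01.
have n1 : \forall s \near (0 : C), 0 < Re (1 + s).
  have h1 : hol (fun s : C => 1 + s) 0 by apply: holD; [exact: hol_cst|exact: hol_id].
  exact: (near_Re_hol h1 R1).
have n2 := near0N n1.
have n3 : \forall s \near (0 : C), 0 < Re (unifA s / unifA (- s)).
  apply: (@near_Re_hol (fun s : C => unifA s / unifA (- s)) 0 (hol_ratio R1 R1')).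
  by rewrite oppr0 unifA0 divr1 /= ltr01.
have B0 : 0 < Re (unifB 0).
  rewrite unifB0 -[2]/(2%:R) divr_natC -(rmorph_nat (real_complex R)) /= divr_gt0 ?ltr0n //.
have n4 : \forall s \near (0 : C), 0 < Re (unifB s).
  exact: (near_Re_hol (hol_unifB R1 R1' (sumA_neq0 B0)) B0).
have n5 := near0N n4.
by apply: filterS2 (filterI n1 n2) (filterI n3 (filterI n4 n5)) => s [? ?] [? [? ?]]; split.
Qed.

Lemma unifV_sqr s : regular s -> unifV s ^+ 2 = unifA s / unifA (- s).
Proof. by move=> [_ _ h _ _]; exact: proot_pow. Qed.

Lemma sector_unifV s : regular s -> sector (unifV s).
Proof. by move=> [_ _ h _ _]; exact: sector_proot2. Qed.

Lemma unifVN s : regular s -> unifV (- s) = (unifV s)^-1.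
Proof.
move=> rs; apply: sqr_inj_Re; first exact: sector_Re (sector_unifV (regularN rs)).
  exact: sector_Re (sectorV (sector_unifV rs)).
by rewrite exprVn (unifV_sqr (regularN rs)) (unifV_sqr rs) opprK invf_div.
Qed.

(** The quotient is a square root of A(s) A(-s), hence even in s. Near the branch point c it is c /
    z. *)
Lemma unifAV_N s : regular s -> unifA (- s) / unifV (- s) = unifA s / unifV s.
Proof.
move=> rs; rewrite (unifVN rs) invrK.
apply: (mulIf (unifV_neq0 s)); rewrite (divfK (unifV_neq0 s)) -mulrA -expr2 (unifV_sqr rs).
by rewrite mulrC (divfK (unifA_neq0 _)).
Qed.

(** The power is (1 + s)(1 - s); at s = [sg z] this equals (b / z)^(2p). *)
Lemma unifAV_pow s : regular s -> (unifA s / unifV s) ^+ (2 * p) = 1 - s ^+ 2.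
Proof.
move=> rs; have [h1 h2 _ _ _] := rs.
have -> : (unifA s / unifV s) ^+ (2 * p) = unifA s ^+ p * unifA (- s) ^+ p.
  rewrite exprM expr_div_n (unifV_sqr rs) -exprMn; congr (_ ^+ _).
  move: (unifA_neq0 s) (unifA_neq0 (- s)).
  by move: (unifA s) (unifA (- s)) => a b a0 b0; field; rewrite a0 b0.
by rewrite (unifA_pow h1) (unifA_pow h2); ring.
Qed.

(** The sum in [unifB] is symmetric in A(s) and A(-s), so B(-s) = V^2 B(s). Both V and the root of B
    lie in the sector, so their product is principal. *)
Lemma unifBN s : regular s -> proot 2 (unifB (- s)) = unifV s * proot 2 (unifB s).
Proof.
move=> rs; have [_ _ _ h4 h5] := rs.
apply: proot2_uniq; first exact: h5.
  by apply: sectorM; [exact: sector_unifV|exact: sector_proot2].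
rewrite exprMn (proot_pow (isT : 0 < 2)%N h4) (unifV_sqr rs) /unifB opprK.
have E := sum_exprM_rev (unifA (- s)) (unifA s) p; rewrite E {E}.
have := sumA_neq0 h4; set T := \sum_(k < p) _ => T0.
move: (unifA_neq0 s) (unifA_neq0 (- s)).
by move: (unifA s) (unifA (- s)) => a b a0 b0; field; rewrite a0 b0 T0.
Qed.

(** A(s)^p - A(-s)^p = 2 s factors as A(s) - A(-s) times the sum in [unifB]; dividing by A(s) and
    that sum gives 1 - A(-s) / A(s). *)
Lemma unifB_sqr s : regular s -> s * unifB s = 1 - (unifV s ^+ 2)^-1.
Proof.
move=> rs; have [h1 h2 _ h4 _] := rs.
have := subrXX (unifA s) (unifA (- s)) p; rewrite (unifA_pow h1) (unifA_pow h2).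
rewrite (unifV_sqr rs) invf_div /unifB.
have := sumA_neq0 h4; set T := \sum_(k < p) _ => T0 e.
have es : (unifA s - unifA (- s)) * T = s * 2 by rewrite -e; ring.
clear e; move: T0 es (unifA_neq0 s); move: T (unifA s) (unifA (- s)) => T a b T0 es a0.
rewrite mulrA -es; field.
by rewrite a0 T0.
Qed.

End Uniformized.

(** * The sheets as functions of the fourth root *)

Section Turn.
Variable R : realType.
Local Notation C := (R[i]^o).
Variables (p n : nat) (c2 : R).
Hypotheses (p_gt0 : (0 < p)%N) (c2_gt0 : 0 < c2).
Local Notation om := (@omega_pow R p).
Local Notation A := (unifA p).
Local Notation V := (unifV p).
Local Notation S := (unifS p c2).
Local Notation E := (unifE p).

Lemma Re_cA (s : R[i]) : 0 < Re (c2%:C * A s).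
Proof. by rewrite Re_real_mul mulr_gt0 // Re_proot. Qed.

Lemma unifSN (s : R[i]) : regular p s -> S (- s) = S s / V s.
Proof.
move=> rs; apply: proot2_uniq; first exact: Re_cA.
  by apply: sectorM; [apply: sector_proot2; exact: Re_cA|apply: sectorV; exact: sector_unifV].
rewrite expr_div_n (unifV_sqr rs) (proot_pow (isT : 0 < 2)%N (Re_cA s)).
move: (unifA_neq0 p s) (unifA_neq0 p (- s)).
by move: (A s) (A (- s)) => a b a0 b0; field; rewrite a0 b0.
Qed.

Lemma hol_unifS (s : C) : regular p s -> hol S s.
Proof.
move=> [h1 _ _ _ _].
apply: (@hol_comp R (proot 2) (fun s : C => c2%:C * A s)); last by apply: hol_proot => //; exact: Re_cA.
by apply: holM; [exact: hol_cst|exact: hol_unifA].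
Qed.

(** The transformation law is part of the condition: its two sides have equal squares, and the sign
    is settled by their agreement at s = 0, hence near 0. *)
Definition regular_gap (z s : R[i]) : Prop :=
  z != 1 -> [/\ 0 < Re (1 - z / V s ^+ 2), 0 < Re (1 - z * V s ^+ 2) &
    proot 2 (1 - z * V s ^+ 2) = turn_coef z * V s * proot 2 (1 - z^-1 / V s ^+ 2)].

Lemma near_regular_gap (z : R[i]) : `|z| = 1 -> \forall s \near (0 : C), regular_gap z s.
Proof.
move=> z1.
have [->|zn1] := eqVneq z 1; first by apply: filterE => s; rewrite /regular_gap eqxx.
have zV1 : z^-1 != 1 by rewrite invr_eq1.
have z0 : z != 0 by rewrite -normr_eq0 z1 oner_neq0.
have hV : hol V 0 := hol_unifV p_gt0 (nbhs_singleton (near_regular R p_gt0)).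
have hV2 : hol (fun s : C => V s ^+ 2 : C) 0.
  apply: holX.
  exact: hV.
have V2n0 (s : R[i]) : V s ^+ 2 != 0 by rewrite expf_neq0 ?unifV_neq0.
have hq (u : R[i]) : hol (fun s => 1 - u / V s ^+ 2) 0.
  apply: holB; first exact: hol_cst.
  by apply: holM; [exact: hol_cst|apply: holV; [exact: hV2|exact: V2n0]].
have hm : hol (fun s => 1 - z * V s ^+ 2) 0.
  by apply: holB; [exact: hol_cst|apply: holM; [exact: hol_cst|exact: hV2]].
have hr : hol (fun s => proot 2 (1 - z * V s ^+ 2)) 0.
  apply: (@hol_comp R (proot 2) (fun s : C => 1 - z * V s ^+ 2)); first exact: hm.
  by apply: hol_proot => //; rewrite unifV0 expr1n mulr1; exact: Re_1sub.
have hl : hol (fun s => turn_coef z * V s * proot 2 (1 - z^-1 / V s ^+ 2)) 0.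
  apply: holM; first by apply: holM; [exact: hol_cst|exact: hV].
  apply: (@hol_comp R (proot 2) (fun s : C => 1 - z^-1 / V s ^+ 2)); first exact: hq.
  by apply: hol_proot => //; rewrite unifV0 expr1n divr1; apply: Re_1sub; rewrite ?normV1.
have n1 : \forall s \near (0 : C), 0 < Re (1 - z / V s ^+ 2).
  by apply: (near_Re_hol (hq z)); rewrite unifV0 expr1n divr1; exact: Re_1sub.
have n2 : \forall s \near (0 : C), 0 < Re (1 - z * V s ^+ 2).
  by apply: (near_Re_hol hm); rewrite unifV0 expr1n mulr1; exact: Re_1sub.
have n3 : \forall s \near (0 : C), 0 < Re (1 - z^-1 / V s ^+ 2).
  by apply: (near_Re_hol (hq z^-1)); rewrite unifV0 expr1n divr1; apply: Re_1sub; rewrite ?normV1.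
have n4 : \forall s \near (0 : C), proot 2 (1 - z * V s ^+ 2) =
    turn_coef z * V s * proot 2 (1 - z^-1 / V s ^+ 2).
  apply: (pow_eq_cts (isT : 0 < 2)%N (hol_cts hr) (hol_cts hl)).
  - rewrite unifV0 expr1n !mulr1 divr1 /turn_coef (negPf zn1).
    by rewrite (divfK (proot_neq0 _ _)).
  - rewrite mulf_neq0 ?proot_neq0 // mulf_neq0 ?unifV_neq0 //.
    by apply: Re_gt0_neq0; exact: Re_turn_coef.
  apply: filterS2 n2 n3 => s s2 s3.
  rewrite (proot_pow (isT : 0 < 2)%N s2) [RHS]exprMn (proot_pow (isT : 0 < 2)%N s3) (exprMn 2 (turn_coef z)) turn_coef_sqr //.
  move: (V2n0 s); move: (V s) => v v0; field.
  by rewrite z0 andbT; apply: contraNneq v0 => ->; rewrite expr0n.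
by apply: filterS2 (filterI n1 n2) n4 => s [s1 s2] s4.
Qed.

Lemma sqr_i_mul (r : R[i]) : ('i%C * r) ^+ 2 = - r ^+ 2.
Proof. by rewrite exprMn sqr_i mulN1r. Qed.

Lemma unifE_turn (z r : R[i]) : regular p (r ^+ 2) -> regular_gap z (r ^+ 2) ->
  E z ('i%C * r) = turn_coef z * V (r ^+ 2) * E z^-1 r.
Proof.
move=> rr rz; rewrite /unifE invr_eq1 sqr_i_mul.
have [->|/rz[_ _ e]] := eqVneq z 1.
  by rewrite (unifBN rr) /turn_coef eqxx; ring.
by rewrite (unifVN rr) exprVn invrK e.
Qed.

Lemma unifE_neq0 (z r : R[i]) : r != 0 -> E z r != 0.
Proof. by move=> r0; rewrite /unifE; case: ifP => _; [apply: mulf_neq0 => //|]; exact: proot_neq0. Qed.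

Lemma hol_comp_sqr (f : C -> C) (r : C) : hol f (r ^+ 2) -> hol (fun r => f (r ^+ 2)) r.
Proof.
move=> h; apply: (@hol_comp R f (fun r : C => r ^+ 2)); last exact: h.
by apply: holX; exact: hol_id.
Qed.

Lemma hol_unifE (z : R[i]) (r : C) : regular p (r ^+ 2) -> regular_gap z (r ^+ 2) -> hol (E z) r.
Proof.
move=> rr rz; rewrite /unifE.
have [_|/rz[h _ _]] := eqVneq z 1.
  apply: holM; first exact: hol_id.
  apply: (@hol_comp_sqr (fun s => proot 2 (unifB p s))).
  have [h1 h2 _ h4 _] := rr.
  apply: (@hol_comp R (proot 2) (unifB p)); last exact: hol_proot.
  by apply: hol_unifB => //; exact: sumA_neq0.
apply: (@hol_comp R (proot 2) (fun r : C => 1 - z / V (r ^+ 2) ^+ 2)); last exact: hol_proot.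
apply: holB; first exact: hol_cst.
apply: holM; first exact: hol_cst.
apply: holV; last by rewrite expf_neq0 ?unifV_neq0.
apply: holX; apply: hol_comp_sqr; exact: hol_unifV.
Qed.

Definition good (r : R[i]) : Prop :=
  regular p (r ^+ 2) /\ forall j a : 'I_p, regular_gap (gap R n j a) (r ^+ 2).

Lemma near_good_sqr :
  \forall s \near (0 : C), regular p s /\ forall j a : 'I_p, regular_gap (gap R n j a) s.
Proof.
apply: filterI; first exact: near_regular.
apply: (@filter_forall _ _ _ _ (nbhs_filter (0 : C))) => j.
apply: (@filter_forall _ _ _ _ (nbhs_filter (0 : C))) => a.
by apply: near_regular_gap; exact: norm_gap.
Qed.

Lemma near_good : \forall r \near (0 : C), good r.
Proof.
have n2 := near_good_sqr.
have h : hol (fun r : C => r ^+ 2 : C) 0 by apply: holX; exact: hol_id.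
have h0 : (fun r : C => r ^+ 2 : C) @ (0 : C) --> ((0 : C) ^+ 2 : C) := hol_cts h.
have e : (0 : C) ^+ 2 = 0 by rewrite expr2 mul0r.
rewrite e in h0.
exact: (h0 _ n2).
Qed.

Definition sheetD (j : 'I_p) (r : R[i]) : R[i] :=
  \prod_(a < p | a != j) (S (r ^+ 2) * E (gap R n j a) r).

(** In each factor the V from [unifE_turn] cancels the 1 / V from [unifSN], so only the turn
    coefficients remain; the reflection then permutes the factors. *)
Lemma sheetD_turn (j : 'I_p) (r : R[i]) : good r ->
  sheetD j ('i%C * r) = (exchange_coef R n j)^-1 * sheetD (reflect_ord n j) r.
Proof.
move=> [rr rg].
have fact (a : 'I_p) : S (('i%C * r) ^+ 2) * E (gap R n j a) ('i%C * r) =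
    turn_coef (gap R n j a) * (S (r ^+ 2) * E (gap R n j a)^-1 r).
  rewrite (unifE_turn rr (rg j a)) sqr_i_mul (unifSN rr).
  have := unifV_neq0 p (r ^+ 2); move: (V (r ^+ 2)) (S _) (turn_coef _) (E _ _) => v s t e v0.
  by field.
rewrite /sheetD (eq_bigr _ (fun a _ => fact a)).
rewrite big_split; congr (_ * _).
  have i0 : 'i%C != 0 :> R[i] by rewrite -normr_eq0 normCE /= expr0n add0r expr1n sqrtr1 oner_neq0.
  have := prod_turn_coef R n p_gt0 j; rewrite (bigD1 j (isT : xpredT j)) turn_coef_exchange => [e|//].
  have x0 := exchange_coef_neq0 R n j.
  apply: (mulfI (mulf_neq0 i0 x0)).
  by rewrite e mulfK.
rewrite /sheetD [RHS](reindex_inj (inv_inj (@reflect_ordK p n))) /=.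
apply: eq_big => [a|a _]; first by rewrite (inj_eq (inv_inj (@reflect_ordK p n))).
by rewrite gap_reflect.
Qed.

Lemma hol_sheetD (j : 'I_p) (r : C) : good r -> hol (sheetD j) r.
Proof.
move=> [rr rg]; apply: hol_prod => a _; apply: holM; last by apply: hol_unifE.
apply: (@hol_comp_sqr S); exact: hol_unifS.
Qed.

Lemma sheetD_neq0 (j : 'I_p) (r : R[i]) : r != 0 -> sheetD j r != 0.
Proof.
by move=> r0; apply/prodf_neq0 => a _; apply: mulf_neq0; [exact: proot_neq0|exact: unifE_neq0].
Qed.

(** exp tau_j as a function of r. *)
Definition sheetW (j : 'I_p) (r : R[i]) : R[i] := om (n%:R / 2 - j%:R) * V (r ^+ 2).

Lemma sheetW_neq0 (j : 'I_p) (r : R[i]) : sheetW j r != 0.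
Proof. exact: mulf_neq0 (om_neq0 _ _) (unifV_neq0 _ _). Qed.

Lemma om_reflect (j : 'I_p) : om (reflect_ord n j)%:R = om (n%:R - j%:R).
Proof.
apply: (mulIf (om_neq0 p (j%:R : R))); rewrite -!omD subrK -natrD.
by apply: om_eq_mod => //; apply/eqP; rewrite reflect_ordP reflect_ordK.
Qed.

Lemma sheetW_turn (j : 'I_p) (r : R[i]) : good r ->
  sheetW j ('i%C * r) = (sheetW (reflect_ord n j) r)^-1.
Proof.
move=> [rr _]; rewrite /sheetW sqr_i_mul (unifVN rr) [RHS]invfM; congr (_ * _).
rewrite -omN opprB [RHS]omD om_reflect -omD; congr (om _).
lra.
Qed.

Lemma hol_sheetW (j : 'I_p) (r : C) : good r -> hol (sheetW j) r.
Proof.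
move=> [rr _]; apply: holM; first exact: hol_cst.
by apply: (@hol_comp_sqr V); exact: hol_unifV.
Qed.

(** cosh (m t) for w = exp t. Evenness of cosh makes it invariant under the inversion of w in
    [sheetW_turn]. *)
Definition chW (m : nat) (w : R[i]) : R[i] := (w ^+ m + w^-1 ^+ m) / 2.

Lemma chWV m w : chW m w^-1 = chW m w.
Proof. by rewrite /chW invrK addrC. Qed.

Lemma hol_chW m (f : C -> C) (z : C) : hol f z -> f z != 0 -> hol (fun z => chW m (f z)) z.
Proof.
move=> hf f0; apply: holM; last exact: hol_cst.
apply: holD; first by apply: holX; exact: hf.
by apply: holX; apply: holV; [exact: hf|exact: f0].
Qed.

Variables (cc kappa K x1 x2 : R[i]) (m1 m2 : nat).

(** K, x1, x2, m1, m2 stand for the prefactor, p + q, q - p, p + q and |q - p| of the Chebyshev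
    entry. *)
Definition sheetPhi (j : 'I_p) (r : R[i]) : R[i] :=
  K * (chW m1 (sheetW j r) / x1 - chW m2 (sheetW j r) / x2).

Lemma sheetPhi_turn (j : 'I_p) (r : R[i]) : good r ->
  sheetPhi j ('i%C * r) = sheetPhi (reflect_ord n j) r.
Proof. by move=> g; rewrite /sheetPhi (sheetW_turn j g) (chWV m1) (chWV m2). Qed.

Lemma hol_sheetPhi (j : 'I_p) (r : C) : good r -> hol (sheetPhi j) r.
Proof.
move=> g; apply: holM; first exact: hol_cst.
have hw : hol (sheetW j) r by exact: hol_sheetW.
have w0 := sheetW_neq0 j r.
by apply: holB; (apply: holM; last exact: hol_cst); exact: (@hol_chW _ (sheetW j) r hw w0).
Qed.

(** With [cc] the branch point, the last factor is 1 / z expressed through r. *)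
Definition sheetG (j : 'I_p) (r : R[i]) : R[i] :=
  kappa * chW 1 (sheetW j r) * (A (r ^+ 2) / V (r ^+ 2) / cc).

Lemma sheetG_turn (j : 'I_p) (r : R[i]) : good r ->
  sheetG j ('i%C * r) = sheetG (reflect_ord n j) r.
Proof.
by move=> g; have [rr _] := g; rewrite /sheetG (sheetW_turn j g) (chWV 1) sqr_i_mul (unifAV_N rr).
Qed.

Lemma hol_sheetG (j : 'I_p) (r : C) : good r -> hol (sheetG j) r.
Proof.
move=> g; have [rr _] := g; have [h1 _ _ _ _] := rr.
apply: holM.
  apply: holM; first exact: hol_cst.
  by apply: (@hol_chW 1 (sheetW j)); [exact: hol_sheetW|exact: sheetW_neq0].
apply: holM; last exact: hol_cst.
apply: holM; first by apply: (@hol_comp_sqr A); exact: hol_unifA.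
apply: holV; last exact: unifV_neq0.
by apply: (@hol_comp_sqr V); exact: hol_unifV.
Qed.

Definition sheetZ (i j : 'I_p) (r : R[i]) : R[i] :=
  p%:R^-1 * (sheetD j r)^-1 * \sum_(k < p) (om i%:R * sheetG j r) ^+ k.

Lemma sheetZ_turn (i j : 'I_p) (r : R[i]) : good r ->
  sheetZ i j ('i%C * r) = sheetZ i (reflect_ord n j) r * exchange_coef R n j.
Proof.
move=> g; rewrite /sheetZ (sheetD_turn j g) (sheetG_turn j g).
have := exchange_coef_neq0 R n j; have := @invrK R[i] (exchange_coef R n j).
move: (sheetD _ r) (exchange_coef R n j) (\sum_(k < p) _) => d e t ee e0.
by rewrite invfM ee; move: (p%:R^-1) (d^-1) => u v; ring.
Qed.

(** When the reflection moves j, the factor of [sheetD] with gap 1 vanishes at r = 0; hence the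
    punctured disc in [continuation_root4]. *)
Lemma hol_sheetZ (i j : 'I_p) (r : C) : r != 0 -> good r -> hol (sheetZ i j) r.
Proof.
move=> r0 g; apply: holM.
  apply: holM; first exact: hol_cst.
  by apply: holV; [exact: hol_sheetD|exact: sheetD_neq0].
apply: hol_sum => k _; apply: holX; apply: holM; first exact: hol_cst.
exact: hol_sheetG.
Qed.

End Turn.

(** * Closed forms on the exterior domain *)

Lemma cvg_near_eq (T U : Type) (F : set_system T) {FF : Filter F} (f g : T -> U)
    (G : set_system U) : (\forall t \near F, f t = g t) -> f @ F --> G -> g @ F --> G.
Proof.
move=> e fG B /fG fB.
by apply: filterS2 e fB => t /= ->.
Qed.

Section Exterior.
Variable R : realType.
Local Notation C := (R[i]^o).
Variables (mu : R) (p : nat).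
Hypotheses (mu_gt0 : 0 < mu) (p_gt0 : (0 < p)%N).
Local Notation om := (@omega_pow R p).
Local Notation b := (branch_radius mu p).
Local Notation kappa := (mu `^ ((2 * p%:R)^-1)).
Local Notation A := (unifA p).

Definition sg (z : R[i]) : R[i] := proot 2 (sigma b (2 * p) z).

Let p_neq0 : p%:R != 0 :> R. Proof. by rewrite pnatr_eq0 -lt0n. Qed.
Let p2_gt0 : (0 < 2 * p)%N. Proof. by rewrite muln_gt0. Qed.
Let sqrtmu_gt0 : 0 < 2 * Num.sqrt mu. Proof. by rewrite mulr_gt0 // sqrtr_gt0. Qed.

Lemma branch_radius_gt0 : 0 < b.
Proof. by rewrite /branch_radius mulr_gt0 ?invr_gt0 // powR_gt0. Qed.

Lemma branch_radius_pow : (2 * b) ^+ p = 2 * Num.sqrt mu.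
Proof.
rewrite /branch_radius mulrA divff ?mul1r // -powR_mulrn ?powR_ge0 // -powRrM.
by rewrite mulVf // powRr1 // ltW.
Qed.

(** The constant in front of A in [gamma_diff]. By [scaleE] it is 2^(-1/p), which normalizes [unifS]
    to 1 at infinity. *)
Definition scale : R := kappa / (2 * b).

Lemma scale_gt0 : 0 < scale.
Proof. by rewrite divr_gt0 ?powR_gt0 // mulr_gt0 // branch_radius_gt0. Qed.

Lemma scaleE : scale * 2 `^ p%:R^-1 = 1.
Proof.
rewrite /scale /branch_radius mulrA divff ?mul1r // powRM ?sqrtr_ge0 //.
rewrite -powR12_sqrt ?(ltW mu_gt0) // -powRrM invfM.
have h1 := powR_gt0 p%:R^-1 (ltr0Sn R 1); have h2 := powR_gt0 (2^-1 * p%:R^-1) mu_gt0.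
by field; rewrite !gt_eqF.
Qed.

Lemma ext_neq0 (z : R[i]) : exterior mu p z -> z != 0.
Proof.
rewrite /exterior /= => h; rewrite -normr_gt0; apply: lt_trans h.
by rewrite ltcR branch_radius_gt0.
Qed.

Lemma ext_sigma (z : R[i]) : exterior mu p z -> 0 < Re (sigma b (2 * p) z).
Proof. by move=> h; apply: Re_sigma => //; exact: branch_radius_gt0. Qed.

Lemma Re_sg (z : R[i]) : 0 < Re (sg z).
Proof. exact: Re_proot. Qed.

Lemma Re_1sg (z : R[i]) : 0 < Re (1 + sg z).
Proof. by rewrite raddfD /= addr_gt0 ?ltr01 ?Re_sg. Qed.

Lemma hol_sg (z : C) : exterior mu p z -> hol sg z.
Proof.
move=> h; apply: (@hol_comp R (proot 2) (sigma b (2 * p))).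
  by apply: hol_sigma; exact: ext_neq0.
by apply: hol_proot => //; exact: ext_sigma.
Qed.

Lemma hol_Asg (z : C) : exterior mu p z -> hol (fun z => A (sg z)) z.
Proof.
move=> h; apply: (@hol_comp R A sg); first exact: hol_sg.
by apply: hol_unifA => //; exact: Re_1sg.
Qed.

Lemma sg_sqr (z : R[i]) : exterior mu p z -> sg z ^+ 2 = 1 - (b%:C / z) ^+ (2 * p).
Proof. by move=> h; apply: proot_pow => //; exact: ext_sigma. Qed.

Lemma norm_1sub_1add (s : R[i]) : 0 < Re s -> `|1 - s| < `|1 + s|.
Proof.
move=> s0; have h : `|1 - s| ^+ 2 < `|1 + s| ^+ 2.
  rewrite -!add_Re2_Im2 ltcR; case: s s0 => x y /= x0; nra.
by move: h; rewrite ltr_pXn2r // nnegrE normr_ge0.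
Qed.

Lemma inv_cinfty : (fun z : R[i] => z^-1 : C) @ @cinfty R --> (0 : C).
Proof.
apply: (iffRL (@cvgrPdist_lt _ C _ (@cinfty R) (@cinfty_filter R) (fun z : R[i] => z^-1 : C) (0 : C))) => e e0.
have er : e = (Re e)%:C by rewrite RRe_real ?gtr0_real.
have e0' : 0 < Re e by move: e0; rewrite er -ltcR.
exists (Re e)^-1 => z ez; rewrite sub0r normrN normfV er.
have z0 : 0 < `|z| by apply: lt_trans ez; rewrite ltcR invr_gt0.
rewrite fmorphV in ez.
have e1 : (Re e)%:C \is Num.pos by rewrite posrE ltcR.
have z1 : `|z| \is Num.pos by rewrite posrE.
by rewrite (invf_plt z1 e1).
Qed.

Lemma sg_cinfty : sg @ @cinfty R --> (1 : C).
Proof.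
have h1 : (fun z : R[i] => b%:C / z : C) @ @cinfty R --> (0 : C).
  have := @cvgM C _ (@cinfty R) (@cinfty_filter R) _ _ _ _ (cvg_cst (b%:C : C)) inv_cinfty.
  by rewrite mulr0; apply.
have hf : hol (fun u : C => proot 2 (1 - u ^+ (2 * p))) 0.
  apply: (@hol_comp R (proot 2) (fun u : C => 1 - u ^+ (2 * p))).
    by apply: holB; [exact: hol_cst|apply: holX; exact: hol_id].
  by apply: hol_proot => //; rewrite expr0n gtn_eqF // subr0 /= ltr01.
have h2 : sg @ @cinfty R --> (proot 2 (1 - (0 : C) ^+ (2 * p)) : C) := cvg_comp _ _ h1 (hol_cts hf).
have e : (0 : C) ^+ (2 * p) = 0 by apply/eqP; rewrite expf_eq0 p2_gt0 eqxx.
rewrite e subr0 proot1 in h2; exact: h2.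
Qed.

Lemma Asg_cinfty : (fun z => A (sg z) : C) @ @cinfty R --> ((2 `^ p%:R^-1)%:C : C).
Proof.
have R2 : 0 < Re (1 + 1 : R[i]) by rewrite /= addr_gt0 ?ltr01.
have h2 : (fun z => A (sg z) : C) @ @cinfty R --> (A 1 : C).
  exact: (cvg_comp _ _ sg_cinfty (hol_cts (hol_unifA p_gt0 R2))).
have e : A 1 = ((2 : R) `^ p%:R^-1)%:C.
  transitivity (proot p (2 : R)%:C); last exact: proot_real.
  by rewrite /unifA; congr (proot p _); apply/eqP; rewrite eq_complex /= addr0 !eqxx.
by rewrite -e.
Qed.

(** * The exponential of the uniformizing variable *)

Section Uniformizer.
Variable tau : R[i] -> R[i].
Hypothesis tauP : is_uniformizer mu p tau.
Let w (z : R[i]) : R[i] := cexp (tau z).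

Lemma norm_w (z : R[i]) : exterior mu p z -> 1 < `|w z|.
Proof.
move=> h; have [_ t0 _ _] := tauP.
by rewrite /w normc_cexp (_ : 1 = 1%:C) // ltcR expR_gt1 t0.
Qed.

Lemma w_neq0 (z : R[i]) : w z != 0. Proof. exact: cexp_neq0. Qed.

Lemma bC_neq0 : b%:C != 0 :> R[i].
Proof. by rewrite -[0]/(0%:C) (inj_eq (@complexI R)) gt_eqF // branch_radius_gt0. Qed.

Lemma w_equation (z : R[i]) : exterior mu p z -> 2 * (z / b%:C) ^+ p = w z ^+ p + (w z ^+ p)^-1.
Proof.
move=> h; have [e _ _ _] := tauP; have {e} := e z h.
rewrite /ccosh cexpN cexpMn -/(w z) -branch_radius_pow rmorphXn rmorphM /= => e.
have b0 := bC_neq0; have two0 : (2 : R)%:C != 0 :> R[i].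
  by rewrite -[0]/(0%:C) (inj_eq (@complexI R)) pnatr_eq0.
have h2 : (2 : R)%:C = 2 :> R[i] by rewrite -(rmorph_nat (real_complex R)).
rewrite h2 in e two0.
have {e} := congr1 (fun x => x / (2 * b%:C) ^+ p) e.
rewrite -expr_div_n invfM mulrACA divff // mul1r => ->.
rewrite [_ ^+ p * _]mulrC mulfK ?expf_neq0 ?mulf_neq0 //.
by rewrite mulrC divfK.
Qed.

(** With X = (z / b)^p, the number W = w^p solves W^2 - 2 X W + 1 = 0, whose roots are X (1 + s) and
    X (1 - s), inverse to each other. The first is larger in modulus as Re s > 0, and |W| > 1
    selects it. *)
Lemma w_pow (z : R[i]) : exterior mu p z -> w z ^+ p = (z / b%:C) ^+ p * (1 + sg z).
Proof.
move=> h; have z0 := ext_neq0 h; have b0 := bC_neq0.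
have we := w_equation h; have s2 := sg_sqr h; have sn := norm_1sub_1add (Re_sg z).
have wp : 1 < `|w z ^+ p| by rewrite normrX exprn_egt1 ?norm_w // -lt0n.
have X2 : ((z / b%:C) ^+ p) ^+ 2 * (1 - sg z ^+ 2) = 1.
  rewrite s2 opprB addrCA subrr addr0 -exprM mulnC -exprMn.
  by rewrite mulrA divfK // divff // expr1n.
move: (expf_neq0 p (w_neq0 z)) wp we X2 sn.
move: (w z ^+ p) ((z / b%:C) ^+ p) (sg z) => W X s W0 W1 we X2 sn.
have : (W - X * (1 + s)) * (W - X * (1 - s)) = 0.
  transitivity (W * (W + W^-1 - 2 * X) + X ^+ 2 * (1 - s ^+ 2) - 1); first by field.
  by rewrite X2 -we subrr mulr0 add0r subrr.
move/eqP; rewrite mulf_eq0 !subr_eq0 => /orP[/eqP//|/eqP e].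
have eV : W^-1 = X * (1 + s).
  by rewrite -[LHS](addKr W) -we e; ring.
have X0 : 0 < `|X|.
  by rewrite normr_gt0; apply: contraNneq W0 => X0; rewrite e X0 mul0r.
have : `|W| < `|W^-1| by rewrite eV e !normrM ltr_pM2l.
rewrite normfV => h1.
have iW : `|W|^-1 < 1 by rewrite invf_lt1 // (lt_trans ltr01).
by have := lt_trans (lt_trans W1 h1) iW; rewrite ltxx.
Qed.

Lemma hol_w (z : C) : exterior mu p z -> hol w z.
Proof. by have [_ _ h _] := tauP; exact: h. Qed.

Lemma wE (z : R[i]) : exterior mu p z -> w z = z / b%:C * A (sg z).
Proof.
pose f (z : R[i]) : R[i] := w z * b%:C / (z * A (sg z)).
have b0 := bC_neq0.
have fp z' : exterior mu p z' -> f z' ^+ p = 1.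
  move=> h; have z0 := ext_neq0 h.
  rewrite /f expr_div_n (exprMn p (w z')) (exprMn p z') (w_pow h) (unifA_pow p_gt0 (Re_1sg z')) expr_div_n.
  have s0 := Re_gt0_neq0 (Re_1sg z'); move: (1 + sg z') s0 => s s0.
  by field; rewrite s0 !expf_neq0.
have fc z' : exterior mu p z' -> {for (z' : C), continuous (f : C -> C)}.
  move=> h; apply: hol_cts; apply: holM.
    by apply: holM; [exact: hol_w|exact: hol_cst].
  apply: holV; last exact: mulf_neq0 (ext_neq0 h) (unifA_neq0 p _).
  by apply: holM; [exact: hol_id|exact: hol_Asg].
have f1 : (f : C -> C) @ @cinfty R --> (1 : C).
  have [_ _ _ h1] := tauP.
  have c0 : ((2 `^ p%:R^-1)%:C : C) != 0.
    by rewrite -[0]/(0%:C) (inj_eq (@complexI R)) gt_eqF // powR_gt0.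
  have h2 := @cvgV C _ (@cinfty R) (@cinfty_filter R) _ _ c0 Asg_cinfty.
  have h3 := @cvgM C _ (@cinfty R) (@cinfty_filter R) _ _ _ _ h1
    (@cvgM C _ (@cinfty R) (@cinfty_filter R) _ _ _ _ (cvg_cst ((2 `^ p%:R^-1)%:C : C)) h2).
  rewrite (mulfV c0) mulr1 in h3.
  apply: (@cvg_near_eq R[i] C (@cinfty R) (@cinfty_filter R) _ f (nbhs (1:C)) _ (h3 (@cinfty_filter R))).
  exists b => z' h; rewrite /f /=.
  have m0 : (mu `^ (- (2 * p%:R)^-1))%:C != 0 :> R[i].
    by rewrite -[0]/(0%:C) (inj_eq (@complexI R)) gt_eqF // powR_gt0.
  (* The prescribed asymptotics of exp tau match the limit 2^(1/p) of [A (sg z)] because 2 b = (2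
     sqrt mu)^(1/p). *)
  have e : (2 `^ p%:R^-1)%:C = 2 * b%:C * (mu `^ (- (2 * p%:R)^-1))%:C :> R[i].
    have -> : 2 `^ p%:R^-1 = 2 * b * mu `^ (- (2 * p%:R)^-1).
      apply: (mulfI (lt0r_neq0 scale_gt0)); rewrite scaleE /scale powRN.
      have k0 := powR_gt0 ((2 * p%:R)^-1) mu_gt0; have b1 := branch_radius_gt0.
      by field; rewrite !gt_eqF.
    by rewrite (rmorphM (real_complex R)) (rmorphM (real_complex R)) (rmorph_nat (real_complex R)).
  rewrite e -/(w z'); move: (ext_neq0 h) (unifA_neq0 p (sg z')) m0.
  move: (A (sg z')) (mu `^ _)%:C => a m z0 a0 m0; field.
  by rewrite a0 z0 m0.

move=> h; have := @unity_exterior R b p f p_gt0 branch_radius_gt0 fc fp f1 z h.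
rewrite /f => /(canRL (divfK (mulf_neq0 (ext_neq0 h) (unifA_neq0 p _)))).
rewrite mul1r => e; apply: (mulIf b0).
by rewrite e mulrAC (divfK b0).
Qed.

(** cosh is even, so the absolute value of the multiplier suffices; this serves q - p, which may be
    negative. *)
Lemma ccosh_sheet (k : nat) (x : R) (j : 'I_p) (z : R[i]) : `|x| = k%:R ->
  ccosh (x%:C * tau_sheet tau j z) = chW k (w z * om (- j%:R)).
Proof.
have h : ccosh (k%:R * tau_sheet tau j z) = chW k (w z * om (- j%:R)).
  rewrite /ccosh cexpN cexpMn /chW exprVn.
  suff -> : cexp (tau_sheet tau j z) = w z * om (- j%:R) by [].
  rewrite /tau_sheet cexpD /w /omega_pow; congr (_ * cexp _).
  by apply/eqP; rewrite eq_complex /= oppr0 mulrN mulNr !eqxx.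
have [x0|x0] := leP 0 x; rewrite ?(ger0_norm x0) ?(ltr0_norm x0) => e.
  by rewrite e rmorph_nat.
rewrite (_ : x = - k%:R); last by rewrite -e opprK.
by rewrite rmorphN rmorph_nat mulNr -h /ccosh opprK addrC.
Qed.

(** With x = omega^(-j) and y = omega^(-a), the difference of w x + 1/(w x) and w y + 1/(w y) is w
    (x - y) (1 - 1/(w^2 x y)). *)
Lemma gamma_diff (j a : 'I_p) (z : R[i]) : exterior mu p z -> a != j ->
  (gamma_fun mu tau j z - gamma_fun mu tau a z) / (om (- j%:R) - om (- a%:R)) =
  scale%:C * A (sg z) * (1 - om (j%:R + a%:R) / w z ^+ 2).
Proof.
move=> h aj; have z0 := ext_neq0 h; have b0 := bC_neq0.
have e (k : 'I_p) : gamma_fun mu tau k z =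
    kappa%:C * ((w z * om (- k%:R) + (w z)^-1 * om k%:R) / 2) / z.
  rewrite /gamma_fun; congr (_ * _ / _).
  rewrite -[tau_sheet _ _ _]mul1r -(rmorph1 (real_complex R)) (@ccosh_sheet 1) ?normr1 //.
  by rewrite /chW !expr1 invfM -(omN p (- k%:R)) opprK.
(* Distinctness of the roots is read off [gap_eq1] with n = 2 j: the gap is then omega^(a - j), and
   j is its own reflection. *)
have oja : om (- j%:R) - om (- a%:R) != 0.
  rewrite subr_eq0; apply: contra aj => /eqP oe.
  have g : gap R (j + j) j a = 1.
    by rewrite /gap natrD opprD addrACA subrr add0r omD oe -omD subrr om0.
  have /eqP -> : a == reflect_ord (j + j) j by rewrite -(gap_eq1 R) ?g.
  by rewrite eq_sym -reflect_ordP.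
have -> : scale%:C = kappa%:C / (2 * b%:C) :> R[i].
  rewrite /scale (rmorphM (real_complex R)) fmorphV (rmorphM (real_complex R)).
  by rewrite (rmorph_nat (real_complex R)).
rewrite !e -(mulrA kappa%:C).
have -> : A (sg z) = w z * b%:C / z by rewrite (wE h); field; rewrite z0 b0.
have oj : om j%:R = (om (- j%:R))^-1 by rewrite omN invrK.
have oa : om a%:R = (om (- a%:R))^-1 by rewrite omN invrK.
rewrite (omD p j%:R) oj oa; move: (om_neq0 p (- j%:R : R)) (om_neq0 p (- a%:R : R)) oja (w_neq0 z).
move: (om (- j%:R)) (om (- a%:R)) (w z) => x y v x0 y0 xy v0.
by field; rewrite z0 b0 v0 x0 y0 xy.
Qed.

Lemma Re_1sub_w (m : R) (z : R[i]) : exterior mu p z -> 0 < Re (1 - om m / w z ^+ 2).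
Proof.
move=> h; apply: Re_sub1_gt0.
rewrite normrM norm_om mul1r normfV normrX invf_lt1 ?exprn_gt0 ?(lt_trans ltr01 (norm_w h)) //.
by rewrite exprn_egt1 // norm_w.
Qed.

Lemma inv_w_cinfty : (fun z => (w z)^-1 : C) @ @cinfty R --> (0 : C).
Proof.
have c0 : ((2 `^ p%:R^-1)%:C : C) != 0.
  by rewrite -[0]/(0%:C) (inj_eq (@complexI R)) gt_eqF // powR_gt0.
have h2 := @cvgV C _ (@cinfty R) (@cinfty_filter R) _ _ c0 Asg_cinfty.
have h1 := @cvgM C _ (@cinfty R) (@cinfty_filter R) _ _ _ _ inv_cinfty h2.
have h3 := @cvgM C _ (@cinfty R) (@cinfty_filter R) _ _ _ _ (cvg_cst (b%:C : C)) h1.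
rewrite mul0r mulr0 in h3.
apply: (@cvg_near_eq R[i] C (@cinfty R) (@cinfty_filter R) _ _ (nbhs (0:C)) _ (h3 (@cinfty_filter R))).
exists b => z h /=; rewrite (wE h).
have b0 := bC_neq0; move: (ext_neq0 h) (unifA_neq0 p (sg z)); move: (A (sg z)) => a z0 a0.
by field; rewrite a0 b0 z0.
Qed.

(** * The square-root factors *)

Section SqrtFactors.
Variable sf : 'I_p -> 'I_p -> R[i] -> R[i].
Hypothesis sfP : is_sqrt_factors mu tau sf.

Lemma sfE (j a : 'I_p) (z : R[i]) : a != j -> exterior mu p z ->
  sf j a z = unifS p scale (sg z) * proot 2 (1 - om (j%:R + a%:R) / w z ^+ 2).
Proof.
move=> aj; have [sf2 sfh [K sfK]] := sfP aj.
pose g (z : R[i]) : R[i] := unifS p scale (sg z) * proot 2 (1 - om (j%:R + a%:R) / w z ^+ 2).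
have g0 z' : g z' != 0 by exact: mulf_neq0 (proot_neq0 _ _) (proot_neq0 _ _).
have rA z' : 0 < Re (scale%:C * A (sg z')) by apply: Re_cA => //; exact: scale_gt0.
have fp z' : exterior mu p z' -> (sf j a z' / g z') ^+ 2 = 1.
  move=> h; have g2 : sf j a z' ^+ 2 = g z' ^+ 2.
    rewrite sf2 // gamma_diff // /g [RHS]exprMn.
    have e1 := proot_pow (isT : 0 < 2)%N (rA z').
    have e2 := proot_pow (isT : 0 < 2)%N (Re_1sub_w (j%:R + a%:R) h).
    exact: (congr2 *%R (esym e1) (esym e2)).
  by rewrite expr_div_n g2 (divff (expf_neq0 2 (g0 z'))).
have fc z' : exterior mu p z' -> {for (z' : C), continuous ((fun z => sf j a z / g z) : C -> C)}.
  move=> h; apply: hol_cts; apply: holM; first exact: sfh.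
  apply: holV; last exact: g0.
  apply: holM.
    apply: (@hol_comp R (proot 2) (fun z => scale%:C * A (sg z))).
      by apply: holM; [exact: hol_cst|exact: hol_Asg].
    by apply: hol_proot => //; exact: rA.
  apply: (@hol_comp R (proot 2) (fun z => 1 - om (j%:R + a%:R) / w z ^+ 2)).
    apply: holB; first exact: hol_cst.
    apply: holM; first exact: hol_cst.
    apply: holV; last exact: expf_neq0 (w_neq0 _).
    by apply: holX; exact: hol_w.
  by apply: hol_proot => //; exact: Re_1sub_w.
have f1 : ((fun z => sf j a z / g z) : C -> C) @ @cinfty R --> (1 : C).
  have R1 : 0 < Re (1 : R[i]) by rewrite /= ltr01.
  have l1 : (sf j a : C -> C) @ @cinfty R --> (1 : C).
    apply: (iffRL (@cvgrPdist_lt _ C _ (@cinfty R) (@cinfty_filter R) _ _)) => e e0.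
    have er : e = (Re e)%:C by rewrite RRe_real ?gtr0_real.
    have e0' : 0 < Re e by move: e0; rewrite er -ltcR.
    have big : @cinfty R (fun z => (Num.max 0 (K / Re e))%:C < `|z|) by exists (Num.max 0 (K / Re e)).
    apply: filterS2 sfK big => z' h1 h2; rewrite distrC; apply: le_lt_trans h1 _.
    have z'0 : 0 < `|z'| by apply: le_lt_trans h2; rewrite lecR le_max lexx.
    rewrite ltr_pdivrMr // er -(Re_norm z') -rmorphM ltcR mulrC -ltr_pdivrMr //.
    by apply: le_lt_trans (_ : K / Re e <= Num.max 0 (K / Re e)) _; rewrite ?le_max ?lexx ?orbT // -ltcR Re_norm.
  have l2 : (fun z => unifS p scale (sg z) : C) @ @cinfty R --> (1 : C).
    have h := @cvgM C _ (@cinfty R) (@cinfty_filter R) _ _ _ _ (cvg_cst (scale%:C : C)) Asg_cinfty.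
    rewrite -(rmorphM (real_complex R)) scaleE in h.
    have := cvg_comp _ _ (h (@cinfty_filter R)) (hol_cts (hol_proot (isT : 0 < 2)%N R1)).
    by rewrite proot1.
  have l3 : (fun z => proot 2 (1 - om (j%:R + a%:R) / w z ^+ 2) : C) @ @cinfty R --> (1 : C).
    have hp : hol (fun u : C => proot 2 (1 - om (j%:R + a%:R) * u ^+ 2)) 0.
      apply: (@hol_comp R (proot 2) (fun u : C => 1 - om (j%:R + a%:R) * u ^+ 2)).
        apply: holB; first exact: hol_cst.
        by apply: holM; [exact: hol_cst|apply: holX; exact: hol_id].
      by apply: hol_proot => //; rewrite expr0n mulr0 subr0.
    have h : (fun z => proot 2 (1 - om (j%:R + a%:R) * (w z)^-1 ^+ 2) : C) @ @cinfty R -->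
        (proot 2 (1 - om (j%:R + a%:R) * (0 : C) ^+ 2) : C) := cvg_comp _ _ inv_w_cinfty (hol_cts hp).
    have e : (0 : C) ^+ 2 = 0 by rewrite expr2 mul0r.
    rewrite e mulr0 subr0 proot1 in h.
    apply: (@cvg_near_eq R[i] C (@cinfty R) (@cinfty_filter R) _ _ (nbhs (1:C)) _ h).
    by exists 0 => z' _; rewrite exprVn.
  have l4 := @cvgM C _ (@cinfty R) (@cinfty_filter R) _ _ _ _ l2 l3.
  rewrite mulr1 in l4.
  have l5 := @cvgM C _ (@cinfty R) (@cinfty_filter R) _ _ _ _ l1
     (@cvgV C _ (@cinfty R) (@cinfty_filter R) _ _ (oner_neq0 _) l4).
  rewrite invr1 mulr1 in l5.
  exact: l5.
move=> h; have := @unity_exterior R b 2 (fun z => sf j a z / g z) isT branch_radius_gt0 fc fp f1 z h.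
by move/(canRL (divfK (g0 z))); rewrite mul1r.
Qed.

End SqrtFactors.
End Uniformizer.
End Exterior.

(** * Proof of the monodromy formulas *)

Section Assembly.
Variable R : realType.
Local Notation C := (R[i]^o).
Variables (mu beta : R) (p q : nat) (tau : R[i] -> R[i]) (sf : 'I_p -> 'I_p -> R[i] -> R[i]).
Hypotheses (mu_gt0 : 0 < mu) (p_gt0 : (0 < p)%N).
Hypotheses (tauP : is_uniformizer mu p tau) (sfP : is_sqrt_factors mu tau sf).
Variable n : nat.
Local Notation om := (@omega_pow R p).
Local Notation b := (branch_radius mu p).
Local Notation c := (branch_point mu p n).
Local Notation kappa := (mu `^ ((2 * p%:R)^-1)).
Local Notation sg := (sg mu p).
Local Notation rt := (fun z => root4 (sigma b (2 * p) z)).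
Let w (z : R[i]) : R[i] := cexp (tau z).

Let b_neq0 : b%:C != 0 :> R[i]. Proof. exact: bC_neq0. Qed.

Lemma branch_point_neq0 : c != 0.
Proof. exact: mulf_neq0 b_neq0 (om_neq0 _ _). Qed.

Lemma branch_point_pow : c ^+ (2 * p) = b%:C ^+ (2 * p).
Proof.
rewrite /branch_point exprMn om_pow.
have -> : (2 * p)%:R * (n%:R / 2) = n%:R * p%:R :> R by rewrite natrM; field.
by rewrite omp // mulr1.
Qed.

Lemma sigma_branch_point : sigma b (2 * p) c = 0.
Proof.
by rewrite /sigma expr_div_n branch_point_pow divff ?subrr // expf_neq0.
Qed.

Local Notation F := (within (exterior mu p) (nbhs (c : C))).

(** Within the exterior domain [sg] is a true square root, so |sg|^2 = |sigma|, which tends to 0. *)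
Lemma sg_branch_point : (sg : C -> C) @ F --> (0 : C).
Proof.
have hs : (sigma b (2 * p) : C -> C) @ (c : C) --> (0 : C).
  rewrite -sigma_branch_point; apply: hol_cts; apply: hol_sigma; exact: branch_point_neq0.
have FF : Filter F by exact: within_filter.
apply: (iffRL (@cvgrPdist_lt _ C C F FF (sg : C -> C) (0 : C))) => e e0.
have er : e = (Re e)%:C by rewrite RRe_real ?gtr0_real.
have n1 : \forall x \near (0 : C), `|x| < e ^+ 2.
  apply/nearC; exists (Re e ^+ 2); first by rewrite exprn_gt0 // -ltcR -er.
  by move=> x; rewrite subr0 er -rmorphXn.
apply: (@filterS C (nbhs (c : C)) (nbhs_filter _) _ _ _ (hs _ n1)) => z hz ez.
rewrite sub0r normrN.
have {}hz : `|sigma b (2 * p) z| < e ^+ 2 := hz.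
move: hz; rewrite -(proot_pow (isT : 0 < 2)%N (ext_sigma mu_gt0 p_gt0 ez)) normrX.
by rewrite ltr_pXn2r // nnegrE ?normr_ge0 // ltW.
Qed.

Lemma rt_sqr (z : R[i]) : rt z ^+ 2 = sg z.
Proof. by apply: proot_pow => //; exact: Re_proot. Qed.

(** The second equation is where n enters: every branch point has the same 2p-th power, and c / z is
    close to 1 only near c. *)
Definition linked (z : R[i]) : Prop :=
  good p n (rt z) /\ c / z = unifA p (sg z) / unifV p (sg z).

(** Both sides of the equation have 2p-th power (b / z)^(2p) and tend to 1 at c. *)
Lemma near_linked : \forall z \near F, linked z.
Proof.
have FF : Filter F by exact: within_filter.
have ng := near_good_sqr R n p_gt0.
have ng' : \forall z \near F, regular p (sg z) /\
    forall j a : 'I_p, regular_gap p (gap R n j a) (sg z) by exact: (sg_branch_point ng).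
have r0 : regular p (0 : R[i]) := nbhs_singleton (near_regular R p_gt0).
have c0 := branch_point_neq0.
have hAV : hol (fun s : C => unifA p s / unifV p s : C) 0.
  have [h1 _ _ _ _] := r0.
  apply: holM; first exact: hol_unifA.
  by apply: holV; [exact: hol_unifV|exact: unifV_neq0].
have lf : (fun z => unifA p (sg z) / unifV p (sg z) : C) @ F --> (1 : C).
  have e : unifA p 0 / unifV p 0 = 1 :> R[i] by rewrite unifA0 unifV0 divr1.
  rewrite -e; exact: (cvg_comp _ _ sg_branch_point (hol_cts hAV)).
have lg : (fun z => c / z : C) @ F --> (1 : C).
  have h : hol (fun z : C => c / z : C) c.
    by apply: holM; [exact: hol_cst|apply: holV; [exact: hol_id|exact: c0]].
  have hc : (fun z : C => c / z : C) @ (c : C) --> (c / c : C) := hol_cts h.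
  rewrite (divff c0) in hc.
  exact: (@cvg_within_filter C C _ _ _ (nbhs (1 : C)) _ hc).
have lfg := @cvgM C _ F FF _ _ _ _ lf (@cvgV C _ F FF _ _ (oner_neq0 _) lg).
rewrite invr1 mulr1 in lfg.
have next : \forall z \near F, exterior mu p z by apply: (@filterE C (nbhs (c : C))).
have ne : \forall z \near F, unifA p (sg z) / unifV p (sg z) = c / z.
  have p2 : (0 < 2 * p)%N by rewrite muln_gt0.
  apply: (@pow_eq_near R C F FF (2 * p) _ _ p2 lfg).
    apply: (@filterS _ F FF _ _ _ next) => z h.
    by apply: mulf_neq0; rewrite ?invr_eq0 ?(ext_neq0 mu_gt0 h).
  apply: (@filterS2 _ F FF _ _ _ _ next ng') => z h [rz _].
  rewrite (unifAV_pow p_gt0 rz) (sg_sqr mu_gt0 p_gt0 h) opprB addrCA subrr addr0.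
  by rewrite [RHS]expr_div_n branch_point_pow -expr_div_n.
apply: (@filterS2 _ F FF _ _ _ _ ne ng') => z e [h1 h2]; split; last by rewrite e.
by split=> [|j a]; rewrite rt_sqr.
Qed.

Lemma w_linked (z : R[i]) : exterior mu p z -> linked z -> w z = om (n%:R / 2) * unifV p (sg z).
Proof.
move=> h [_ e].
have z0 := ext_neq0 mu_gt0 h; have := wE mu_gt0 p_gt0 tauP h; rewrite -/(w z) => ->.
have := unifV_neq0 p (sg z); move: e; rewrite {1}/branch_point.
move: (unifA p (sg z)) (unifV p (sg z)) => a v e v0.
have -> : a = b%:C * om (n%:R / 2) / z * v by rewrite e divfK.
by field; rewrite z0 b_neq0.
Qed.

Lemma sheetW_linked (j : 'I_p) (z : R[i]) : exterior mu p z -> linked z ->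
  w z * om (- j%:R) = sheetW n j (rt z).
Proof.
by move=> h l; rewrite (w_linked h l) /sheetW rt_sqr [om (_ - _)]omD mulrAC.
Qed.

Lemma unifE_linked (j a : 'I_p) (z : R[i]) : exterior mu p z -> linked z ->
  proot 2 (1 - om (j%:R + a%:R) / w z ^+ 2) = unifE p (gap R n j a) (rt z).
Proof.
move=> h l; have [[rr rg] _] := l; rewrite rt_sqr in rr.
have o0 := om_neq0 p (n%:R / 2 : R).
have oE : om (n%:R / 2) ^+ 2 = om n%:R by rewrite om_pow; congr (om _); field.
have e : om (j%:R + a%:R) / w z ^+ 2 = gap R n j a / unifV p (sg z) ^+ 2.
  rewrite (w_linked h l) (exprMn 2 (om _)) oE /gap [om (_ - _)]omD omN.
  by rewrite invfM mulrA.
rewrite e /unifE rt_sqr; case: eqP => [g1|//].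
have eb := unifB_sqr p_gt0 rr.
(* For gap 1 the radicand is s B(s) = r^2 B(s); r and the principal root of B lie in the sector, so
   their product is the principal root. *)
apply: proot2_uniq; first by rewrite -e; exact: (Re_1sub_w tauP _ h).
  apply: sectorM; first by apply: sector_proot2; exact: Re_proot.
  by apply: sector_proot2; have [_ _ _ hB _] := rr.
have [_ _ _ hB _] := rr.
transitivity (sg z * unifB p (sg z)); last by rewrite eb g1 mul1r.
rewrite [LHS]exprMn rt_sqr; congr (_ * _); exact: (proot_pow (isT : 0 < 2)%N hB).
Qed.

Lemma sqrt_Delta_linked (j : 'I_p) (z : R[i]) : exterior mu p z -> linked z ->
  sqrt_Delta sf j z = sheetD n (scale mu p) j (rt z).
Proof.
move=> h l; apply: eq_bigr => a aj.
by rewrite (sfE mu_gt0 p_gt0 tauP sfP aj h) (unifE_linked _ _ h l) rt_sqr.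
Qed.

Lemma gamma_linked (j : 'I_p) (z : R[i]) : exterior mu p z -> linked z ->
  gamma_fun mu tau j z = sheetG n c kappa%:C j (rt z).
Proof.
move=> h l; have [_ e] := l; have z0 := ext_neq0 mu_gt0 h.
rewrite /gamma_fun /sheetG rt_sqr -e -(sheetW_linked j h l).
rewrite -[tau_sheet _ _ _]mul1r -(rmorph1 (real_complex R)) (@ccosh_sheet _ _ _ 1) ?normr1 //.
by rewrite [c / z]mulrC mulfK ?branch_point_neq0.
Qed.

Lemma Z_linked (i j : 'I_p) (z : R[i]) : exterior mu p z -> linked z ->
  Z_cl mu tau sf z i j = sheetZ n (scale mu p) c kappa%:C i j (rt z).
Proof.
move=> h l; rewrite mxE /sheetZ (sqrt_Delta_linked j h l); congr (_ * _).
by apply: eq_bigr => k _; rewrite (gamma_linked j h l).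
Qed.

(** |q - p|: one of the truncated differences is 0. *)
Definition dist_pq : nat := (p - q) + (q - p).

Lemma chebyshev_linked (j : 'I_p) (z : R[i]) : exterior mu p z -> linked z ->
  chebyshev_entry mu beta q tau j z =
  sheetPhi n (p%:R * beta * mu `^ ((p + q)%:R / (2 * p%:R)) / 2)%:C
    (p%:R + q%:R) (q%:R - p%:R) (p + q) dist_pq j (rt z).
Proof.
move=> h l; rewrite /chebyshev_entry /sheetPhi -(sheetW_linked j h l).
have -> : (p%:R + q%:R) * tau_sheet tau j z = (p%:R + q%:R : R)%:C * tau_sheet tau j z.
  by rewrite rmorphD !rmorph_nat.
have -> : (q%:R - p%:R) * tau_sheet tau j z = (q%:R - p%:R : R)%:C * tau_sheet tau j z.
  by rewrite rmorphB !rmorph_nat.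
rewrite (@ccosh_sheet _ _ _ (p + q)); last by rewrite -natrD normr_nat.
rewrite (@ccosh_sheet _ _ _ dist_pq) //.
rewrite /dist_pq; have [pq|/ltnW pq] := leqP p q.
  by rewrite -natrB // normr_nat (eqP pq).
by rewrite distrC -natrB // normr_nat (eqP pq) addn0.
Qed.

Lemma norm_branch_point : `|c| = b%:C.
Proof.
by rewrite normrM norm_om mulr1 ger0_norm // ler0c ltW // branch_radius_gt0.
Qed.

(** Reduces continuation to the substitution of ['i%C * r] for r: f and g need closed forms only at
    linked exterior points, which fill a neighbourhood of the base point. *)
Lemma near_monodromy : \forall lambda \near (c : C), `|c| < `|lambda| ->
  forall (Phi : C -> C) (f g : C -> C),
    (forall r : C, r != 0 -> good p n r -> hol Phi r) ->
    (forall z, exterior mu p z -> linked z -> f z = Phi (rt z)) ->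
    (forall z, exterior mu p z -> linked z -> g z = Phi ('i%C * rt z)) ->
    analytic_continuation (small_loop c lambda) f g.
Proof.
have [rho rho0 hrho] := (nearC _ _).1 (near_good R n p_gt0).
have p2 : (0 < 2 * p)%N by rewrite muln_gt0.
have [eta eta0 heta] := continuation_root4 (branch_radius_gt0 p mu_gt0) p2 rho0
  branch_point_neq0 branch_point_pow.
have [d d0 hd] := (nearC _ _).1 near_linked.
apply/nearC; exists (Num.min eta d); first by rewrite lt_min eta0 d0.
move=> lam lc; rewrite norm_branch_point => blam Phi f g hPhi hf hg.
have lce : `|lam - c| < eta%:C by apply: lt_le_trans lc _; rewrite lecR ge_min lexx.
have lcd : `|lam - c| < d%:C by apply: lt_le_trans lc _; rewrite lecR ge_min lexx orbT.
have nl : \forall z \near (lam : C), exterior mu p z /\ linked z.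
  apply/nearC; exists (Num.min (Re `|lam| - b) (d - Re `|lam - c|)).
    by rewrite lt_min !subr_gt0 -!ltcR !Re_norm blam lcd.
  move=> z zl.
  have ze : exterior mu p z.
    rewrite /exterior /=.
    have h : `|z - lam| < (Re `|lam| - b)%:C by apply: lt_le_trans zl _; rewrite lecR ge_min lexx.
    rewrite rmorphB /= Re_norm ltrBrDr -ltrBrDl in h.
    apply: lt_le_trans h _; rewrite lerBlDr.
    have := ler_normB z (z - lam).
    by rewrite (_ : z - (z - lam) = lam) // opprB addrC subrK.
  split=> //; apply: hd => //.
  have h : `|z - lam| < (d - Re `|lam - c|)%:C by apply: lt_le_trans zl _; rewrite lecR ge_min lexx orbT.
  rewrite rmorphB /= Re_norm ltrBrDr in h.
  by apply: le_lt_trans h; rewrite -(subrKA lam z); exact: ler_normD.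
apply: (heta lam lce blam Phi f g).
- move=> r /andP[r0 rr]; apply: hPhi; first by rewrite -normr_gt0.
  by apply: hrho; rewrite subr0.
- by apply: filterS nl => z [z1 z2]; exact: hf.
- by apply: filterS nl => z [z1 z2]; exact: hg.
Qed.

End Assembly.

Theorem theorem3p2 (R : realType) (mu beta : R) (p q : nat)
    (tau : R[i] -> R[i]) (sf : 'I_p -> 'I_p -> R[i] -> R[i])
    (mu_gt0 : 0 < mu) (beta_neq0 : beta != 0)
    (p_ge2 : (2 <= p)%N) (q_ge1 : (1 <= q)%N) (pq_coprime : coprime p q)
    (tauP : is_uniformizer mu p tau) (sfP : is_sqrt_factors mu tau sf)
    (n : nat) (n_lt : (n < 2 * p)%N) :
  \forall lambda \near (branch_point mu p n : R[i]^o),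
    `|branch_point mu p n| < `|lambda| ->
    mx_analytic_continuation (small_loop (branch_point mu p n) lambda)
      (chebyshev_solution mu beta p q tau)
      (fun z => invmx (monodromy_mx R p n) *m
                chebyshev_solution mu beta p q tau z *m monodromy_mx R p n) /\
    mx_analytic_continuation (small_loop (branch_point mu p n) lambda)
      (Z_cl mu tau sf)
      (fun z => Z_cl mu tau sf z *m monodromy_mx R p n).
Proof.
have p_gt0 : (0 < p)%N by exact: ltnW.
have := near_monodromy mu_gt0 p_gt0 n.
apply: filterS => lam H lc; split=> i j.
  (* The multiple by [i == j] makes Phi zero off the diagonal, so one function covers all
     entries. *)
  apply: (H lc (fun r => sheetPhi n (p%:R * beta * mu `^ ((p + q)%:R / (2 * p%:R)) / 2)%:C
    (p%:R + q%:R) (q%:R - p%:R) (p + q) (dist_pq p q) i r *+ (i == j))).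
  - move=> r _ g; case: (i == j); last exact: hol_cst.
    exact: hol_sheetPhi.
  - move=> z ze zl; rewrite /chebyshev_solution !mxE.
    by rewrite (chebyshev_linked _ _ mu_gt0 p_gt0 tauP i ze zl).
  - move=> z ze zl; rewrite /chebyshev_solution conj_monodromy_mx !mxE.
    have [g _] := zl.
    by rewrite sheetPhi_turn // (chebyshev_linked _ _ mu_gt0 p_gt0 tauP _ ze zl).
apply: (H lc (sheetZ n (scale mu p) (branch_point mu p n) (mu `^ ((2 * p%:R)^-1))%:C i j)).
- by move=> r r0 g; apply: hol_sheetZ => //; exact: scale_gt0.
- by move=> z ze zl; exact: Z_linked.
- move=> z ze zl; rewrite mul_monodromy_mx (Z_linked mu_gt0 p_gt0 tauP sfP i _ ze zl).
  have [g _] := zl.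
  by rewrite sheetZ_turn //; exact: scale_gt0.
Qed.
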